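(* For $F\in L^2_{\mathbb{X}}$ with infinite Hoeffding decomposition $F=\sum_{M\in\mathcal{P}_{fin}(\mathbb{N})}F_M=\sum_{p=0}^\infty F^{(p)}$ the following conditions are equivalent: (i) $F\in\operatorname{dom}(L)$. (ii) The series $\sum_{k=1}^\infty D_kF$ converges in $L^2_{\mathbb{X}}$. (iii) $\sup_{m\in\mathbb{N}}\mathbb{E}\bigl[\bigl(\sum_{k=1}^mD_kF\bigr)^2\bigr]<\infty$. (iv) $\sum_{p=1}^\infty p^2\,\mathbb{E}\bigl[(F^{(p)})^2\bigr]=\sum_{M\in\mathcal{P}_{fin}(\mathbb{N})}|M|^2\,\mathbb{E}[F_M^2]<\infty$. In this case, $LF=-\sum_{k=1}^\infty D_kF$ has the infinite Hoeffding decomposition $$LF=-\sum_{M\in\mathcal{P}_{fin}(\mathbb{N})}|M|\,F_M=-\sum_{p=1}^\infty p\,F^{(p)}.$$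
   Context: Let $\mathbb{X}=(X_n)_{n\in\mathbb{N}}$ be a sequence of independent random variables on a probability space $(\Omega,\mathcal{A},\mathbb{P})$, $X_n$ taking values in an arbitrary measurable space. Let $\mathcal{F}=\sigma(\mathbb{X})$, $\mathcal{F}_M=\sigma(X_j:j\in M)$ for $M\subseteq\mathbb{N}$, $\mathcal{F}_n=\mathcal{F}_{\{1,\dotsc,n\}}$, $\mathcal{G}_k=\sigma(X_j:j\neq k)$, $L^2_{\mathbb{X}}=L^2(\Omega,\mathcal{F},\mathbb{P})$; $\kappa$ is counting measure on $\mathbb{N}$ and $\mathbb{P}_{\mathcal F}$ the restriction of $\mathbb{P}$ to $\mathcal{F}$. Hoeffding decomposition: for $F\in L^2_{\mathbb{X}}$ and $M$ in $\mathcal{P}_{fin}(\mathbb{N})$ (finite subsets of $\mathbb{N}$), $F_M:=\sum_{L\subseteq M}(-1)^{|M|-|L|}\mathbb{E}[F\mid\mathcal{F}_L]$ and $F^{(p)}:=\sum_{|M|=p}F_M$; the $F_M$ are pairwise orthogonal and $F=\sum_MF_M=\sum_{p\ge0}F^{(p)}$, all series converging unconditionally in $L^2(\mathbb{P})$. Malliavin operators: $D_kF:=F-\mathbb{E}[F\mid\mathcal{G}_k]$. On the space $\mathcal{S}$ of all $F\in L^2_{\mathbb{X}}$ that are $\mathcal{F}_n$-measurable for some $n$, put $DF:=(D_kF)_{k\in\mathbb{N}}\in L^2(\kappa\otimes\mathbb{P}_{\mathcal F})$. This operator is closable and its closure is denoted by $D:\operatorname{dom}(D)\subseteq L^2_{\mathbb{X}}\to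 L^2(\kappa\otimes\mathbb{P}_{\mathcal F})$. The divergence $\delta$ is the Hilbert space adjoint of $D$: $\operatorname{dom}(\delta)$ consists of all $U\in L^2(\kappa\otimes\mathbb{P}_{\mathcal F})$ for which there is $C<\infty$ with $|\langle DF,U\rangle_{L^2(\kappa\otimes\mathbb{P}_{\mathcal F})}|\le C\|F\|_2$ for all $F\in\operatorname{dom}(D)$, and $\delta U\in L^2_{\mathbb{X}}$ is determined by $\langle DF,U\rangle=\mathbb{E}[F\,\delta U]$ for all $F\in\operatorname{dom}(D)$. The Ornstein-Uhlenbeck generator $L$ has domain $\operatorname{dom}(L)=\{F\in\operatorname{dom}(D): DF\in\operatorname{dom}(\delta)\}$ and is defined by $LF:=-\delta DF$. *)

(* Defs.v *)
From HB Require Import structures.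
From mathcomp Require Import all_boot all_order all_algebra finmap.
From mathcomp Require Import all_classical all_reals all_analysis.
From mathcomp Require summability.

Set Implicit Arguments.
Unset Strict Implicit.
Unset Printing Implicit Defensive.
Import Order.TTheory GRing.Theory Num.Theory.
Import numFieldNormedType.Exports.

Local Open Scope classical_set_scope.
Local Open Scope ring_scope.

(* Elements of an L^2 space are represented by functions: they are compared
   through the L^2 distance or almost everywhere. The sequence X is indexed from
   0, so that F_n is the sigma-algebra generated by the X_j with j < n. *)

Section conditional_expectation.
Context d (T : measurableType d) (R : realType) (P : probability T R).
Implicit Types (G : set (set T)) (F g : T -> R).

(* g is a version of E[F | <<s G >>]. *)
Definition is_cond_exp G F g : Prop :=
  [/\ measurable_fun [set: g_sigma_algebraType G] g,
      P.-integrable [set: T] (EFin \o g) &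
      forall A, <<s G >> A ->
        (\int[P]_(w in A) (g w)%:E = \int[P]_(w in A) (F w)%:E)%E].

Definition cond_exp G F : T -> R := get [set g | is_cond_exp G F g].

End conditional_expectation.

Section malliavin.
Context d (T : measurableType d) (R : realType) (P : probability T R)
  (dE : nat -> measure_display) (E : forall n, measurableType (dE n))
  (X : forall n, {RV P >-> E n}).

Definition mutually_independent : Prop :=
  forall (J : {fset nat}) (A : forall n, set (E n)),
    (forall n, measurable (A n)) ->
    (P (\bigcap_(j in [set` J]) (X j @^-1` A j)) =
     \prod_(j <- J) P (X j @^-1` A j))%E.

(* A generating system of sigma(X_j : j \in M). *)
Definition rv_sets (M : set nat) : set (set T) :=
  \bigcup_(j in M) g_sigma_algebra_preimage (X j).

(* The set T equipped with the sigma-algebra sigma(X). *)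
Definition TX := g_sigma_algebraType (rv_sets setT).

Definition to_TX (w : T) : TX := w.

Lemma measurable_to_TX : measurable_fun [set: T] to_TX.
Proof.
move=> _ B mB; rewrite setTI; apply: smallest_sub B mB => [|B [j _ [A mA <-]]].
  exact: sigma_algebra_measurable.
exact: measurable_funPT.
Qed.

HB.instance Definition _ :=
  @isMeasurableFun.Build _ _ T TX to_TX measurable_to_TX.

(* The image of P under the identity of T, i.e. the restriction of P to
   sigma(X). *)
Definition PX : probability TX R := distribution P to_TX.

Definition prodPX : {measure set (nat * TX) -> \bar R} :=
  (@counting nat R \x PX)%E.

Definition L2X : set (TX -> R) := [set F | F \in Lfun PX 2%:E].

Definition L2prod : set (nat * TX -> R) := [set U | U \in Lfun prodPX 2%:E].

Definition norm2 (F : TX -> R) : \bar R := ('N[PX]_2%:E[EFin \o F])%E.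

Definition norm2prod (U : nat * TX -> R) : \bar R :=
  ('N[prodPX]_2%:E[EFin \o U])%E.

Definition inner_prod (U V : nat * TX -> R) : \bar R :=
  (\int[prodPX]_z (U z * V z)%:E)%E.

Definition L2_lim (J : Type) (Phi : set_system J) (u : J -> TX -> R)
    (G : TX -> R) : Prop :=
  L2X G /\ (fun j => norm2 (fun w => u j w - G w)) @ Phi --> 0%E.

(* Unconditional convergence in L^2 of the series of the f i with Q i: the
   limit is taken along the finite subsets of I, directed by inclusion. *)
Definition L2_sum (I : choiceType) (Q : pred I) (f : I -> TX -> R)
    (G : TX -> R) : Prop :=
  L2_lim summability.totally (fun (A : {fset I}) w => \sum_(i <- A | Q i) f i w) G.

Definition hoeffding (F : TX -> R) (M : {fset nat}) : TX -> R := fun w =>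
  \sum_(K <- fpowerset M)
    (-1) ^+ (#|` M| - #|` K|) * cond_exp P (rv_sets [set` K]) F w.

Definition hoeffding_order (F : TX -> R) (p : nat) : TX -> R :=
  get [set G | L2_sum (fun M : {fset nat} => #|` M| == p) (hoeffding F) G].

Definition malliavin_D (k : nat) (F : TX -> R) : TX -> R := fun w =>
  F w - cond_exp P (rv_sets [set j | j <> k]) F w.

Definition gradient_smooth (F : TX -> R) : nat * TX -> R := fun z =>
  malliavin_D z.1 F z.2.

Definition smooth : set (TX -> R) := [set F | L2X F /\
  exists n, measurable_fun [set: g_sigma_algebraType (rv_sets `I_n)] F].

(* The graph of the closure of gradient_smooth, as an operator on smooth. *)
Definition gradient_graph (F : TX -> R) (U : nat * TX -> R) : Prop :=
  [/\ L2X F, L2prod U &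
      exists f : nat -> TX -> R,
        [/\ forall n, smooth (f n),
            (fun n => norm2 (fun w => f n w - F w)) @ \oo --> 0%E &
            (fun n => norm2prod (fun z => gradient_smooth (f n) z - U z)) @ \oo
              --> 0%E]].

Definition dom_gradient : set (TX -> R) :=
  [set F | exists U, gradient_graph F U].

Definition gradient (F : TX -> R) : nat * TX -> R :=
  get [set U | gradient_graph F U].

Definition dom_divergence : set (nat * TX -> R) := [set U | L2prod U /\
  exists C : R, forall F, dom_gradient F ->
    (`|inner_prod (gradient F) U| <= C%:E * norm2 F)%E].

Definition divergence (U : nat * TX -> R) : TX -> R :=
  get [set G | L2X G /\ forall F, dom_gradient F ->
    inner_prod (gradient F) U = 'E_P[fun w : T => (F w * G w)%R]%E].

Definition dom_OU : set (TX -> R) :=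
  [set F | dom_gradient F /\ dom_divergence (gradient F)].

Definition OU (F : TX -> R) : TX -> R := fun w => - divergence (gradient F) w.

End malliavin.

(* Main.v *)
(** The conditional expectations [E_A = E[. | F_A]] form a family of commuting
    orthogonal projections of L^2(X) with [E_A E_B = E_(A :&: B)] (independence)
    and [E_{0..n-1} F --> F]. Everything except the identification of the
    operators is Hilbert space geometry of such a family: the component
    [F_M] is an orthogonal projection, [D_k] keeps the components with
    [k \in M], and [\sum_(k < m) D_k] multiplies [F_M] by [#|M :&: {0..m-1}|].
    Hence the partial sums converge, or are bounded, exactly when some N has
    the components [|M| F_M]. Finally [F \in dom L] iff such an N exists: for
    smooth G, [<DG, DF> = \sum_M |M| <G_M, F_M>]; if N exists then this is
    [<G, N>] and [E_{0..n-1} F] is a smooth approximation of F in the graph norm;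
    conversely the bound defining the domain of the divergence, tested on
    [\sum_(M <= {0..n-1}) |M| F_M], bounds [\sum_M |M|^2 ||F_M||^2]. *)

Require Import Defs.
From HB Require Import structures.
From mathcomp Require Import all_boot all_order all_algebra finmap.
From mathcomp Require Import all_classical all_reals all_analysis.
From mathcomp Require Import measurable_realfun.
From mathcomp Require summability.
From mathcomp Require Import ring lra.

Set Implicit Arguments.
Unset Strict Implicit.
Unset Printing Implicit Defensive.
Import Order.TTheory GRing.Theory Num.Theory.
Import numFieldNormedType.Exports.

Local Open Scope classical_set_scope.
Local Open Scope ring_scope.

(** * Moebius inversion over finite sets *)

Section moebius.
Context (R : pzRingType) (V : lmodType R).
Implicit Types (a : {fset nat} -> V) (K M : {fset nat}).

(** The definitions compare functions almost everywhere and select conditional expectations, order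
    components, gradient and divergence by [get], whereas the geometry needs true equality. It is
    therefore carried out in an abstract [lmodType]; square integrable functions are sent to such a
    module by [cls], and each operator of the statement is computed under [cls]. The conditional
    expectations are built by hand. For a cylinder the projection onto F_A is explicit: each event
    X_j in B_j with j outside A is replaced by its probability, and this product formula is where
    independence enters. Existence of projections, the composition rule and the convergence are
    checked on cylinders and reach all of L^2 by linearity and limits, because projections contract;
    existence in the limit rests on the completeness of each L^2(F_A). The operator multiplying F_M
    by |M| is unbounded, so it appears as a relation, [number_op]. The closed gradient is known only
    through an approximating sequence; its sections are forced to be D_k F because each D_k is
    continuous and the product norm dominates the norm of every section. *)

Lemma big_fpowersetU1 a k M : k \notin M ->
  \sum_(K <- fpowerset (k |` M)%fset) a K =
  \sum_(K <- fpowerset M) (a K + a (k |` K)%fset).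
Proof.
move=> kM; rewrite big_split/=.
have kK K : (K `<=` M)%fset -> k \notin K.
  by move=> KM; apply: contra kM; exact: (fsubsetP KM).
rewrite -(big_map (fun K => k |` K)%fset xpredT a) -big_cat/=.
apply: perm_big; apply: uniq_perm; first exact: fset_uniq.
  rewrite cat_uniq fset_uniq/=; apply/andP; split.
    apply/hasPn => _ /mapP[L _ ->]; rewrite fpowersetE.
    by apply/negP => /kK; rewrite !inE eqxx.
  rewrite map_inj_in_uniq ?fset_uniq// => K L.
  rewrite !fpowersetE => /kK kK' /kK kL KL; apply/fsetP => i.
  have [->|ik] := eqVneq i k; first by rewrite (negbTE kK') (negbTE kL).
  by have /fsetP/(_ i) := KL; rewrite !inE (negbTE ik).
move=> L; rewrite mem_cat !fpowersetE; apply/idP/orP.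
  move=> LM; case: (boolP (k \in L)) => kL; [right|left].
    apply/mapP; exists (L `\ k)%fset; last by rewrite fsetD1K.
    by rewrite fpowersetE fsubDset.
  apply/fsubsetP => i iL.
  move/fsubsetP: LM => /(_ _ iL); rewrite !inE => /orP[/eqP ik|//].
  by rewrite -ik iL in kL.
case; first by move=> /fsubset_trans; apply; exact: fsubsetU1.
by move=> /mapP[K + ->]; rewrite fpowersetE => KM; exact: fsetUS.
Qed.

(** With [a K] the conditional expectation given F_K, this is the Hoeffding component of index M.
    The truncated subtraction is exact, since K runs over subsets of M. *)
Definition moebius a M : V :=
  \sum_(K <- fpowerset M) (-1) ^+ (#|` M| - #|` K|) *: a K.

(** Subsets are split according to whether they contain k: adding k to both sets keeps the exponent,
    adding it to the large set alone flips the sign. So the transform is an iterated difference, one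
    direction per element of M. *)
Lemma moebiusU1 a k M : k \notin M ->
  moebius a (k |` M)%fset = moebius (fun K => a (k |` K)%fset) M - moebius a M.
Proof.
move=> kM; rewrite /moebius big_fpowersetU1// big_split/= addrC; congr (_ + _).
  rewrite !big_seq; apply: eq_bigr => K; rewrite fpowersetE => KM.
  have kK : k \notin K by apply: contra kM; exact: (fsubsetP KM).
  by rewrite !cardfsU1 kM kK/= subSS.
rewrite -sumrN !big_seq; apply: eq_bigr => K; rewrite fpowersetE => KM.
by rewrite cardfsU1 kM/= add1n subSn ?fsubset_leq_card// exprS mulN1r scaleNr.
Qed.

Lemma fset_indU1 (Q : {fset nat} -> Prop) : Q fset0 ->
  (forall k M, k \notin M -> Q M -> Q (k |` M)%fset) -> forall M, Q M.
Proof.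
move=> Q0 QU M; have [n] := ubnP #|` M|; elim: n M => // n IH M.
have [->//|[k kM]] := fset_0Vmem M; rewrite (cardfsD1 k) kM => Mn.
by rewrite -(fsetD1K kM); apply: QU; [rewrite !inE eqxx|exact: IH].
Qed.

(** By the difference formula the terms for M and for M with k added sum to the transform of the
    shifted family; hence the induction quantifies over [a]. *)
Lemma sum_moebius a K : \sum_(M <- fpowerset K) moebius a M = a K.
Proof.
elim/fset_indU1: K a => [|k K kK IH] a.
  by rewrite fpowerset0 big_seq_fset1 /moebius fpowerset0 big_seq_fset1 subnn scale1r.
rewrite big_fpowersetU1// -[RHS](IH (fun M => a (k |` M)%fset)).
rewrite !big_seq; apply: eq_bigr => M; rewrite fpowersetE => MK.
rewrite moebiusU1; last first.
  by apply: contra kK; exact: (fsubsetP MK).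
by rewrite addrC subrK.
Qed.

Lemma moebius_eq0 a k M : k \in M ->
  (forall K, a (k |` K)%fset = a K) -> moebius a M = 0.
Proof.
move=> kM ak; rewrite -(fsetD1K kM) moebiusU1 ?inE ?eqxx//.
by rewrite (_ : (fun K => _) = a) ?subrr//; exact/funext.
Qed.

End moebius.

(** * Hilbert space geometry of a commuting family of projections *)

Section inner_product.
Context (R : realType) (V : lmodType R).

Record inner_product (dot : V -> V -> R) : Prop := InnerProduct {
  dotC : forall x y, dot x y = dot y x;
  dotDl : forall x y z, dot (x + y) z = dot x z + dot y z;
  dotZl : forall a x y, dot (a *: x) y = a * dot x y;
  dot_ge0 : forall x, 0 <= dot x x;
  dot_eq0 : forall x, dot x x = 0 -> x = 0 }.

Context (dot : V -> V -> R) (ip : inner_product dot).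
Let dotC := dotC ip.
Let dotDl := dotDl ip.
Let dotZl := dotZl ip.
Let dot_ge0 := dot_ge0 ip.
Implicit Types x y z : V.

Lemma dotDr x y z : dot x (y + z) = dot x y + dot x z.
Proof. by rewrite dotC dotDl !(dotC x). Qed.

Lemma dotZr a x y : dot x (a *: y) = a * dot x y.
Proof. by rewrite dotC dotZl dotC. Qed.

Lemma dotNl x y : dot (- x) y = - dot x y.
Proof. by rewrite -scaleN1r dotZl mulN1r. Qed.

Lemma dotNr x y : dot x (- y) = - dot x y.
Proof. by rewrite dotC dotNl dotC. Qed.

Lemma dot0l x : dot 0 x = 0.
Proof. by rewrite -(scale0r 0) dotZl mul0r. Qed.

Lemma dot0r x : dot x 0 = 0.
Proof. by rewrite dotC dot0l. Qed.

Lemma dot_suml (I : Type) (s : seq I) (Q : pred I) (f : I -> V) x :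
  dot (\sum_(i <- s | Q i) f i) x = \sum_(i <- s | Q i) dot (f i) x.
Proof.
by elim/big_rec2: _ => [|i y1 y2 _ <-]; [exact: dot0l|exact: dotDl].
Qed.

Lemma dot_sumr (I : Type) (s : seq I) (Q : pred I) (f : I -> V) x :
  dot x (\sum_(i <- s | Q i) f i) = \sum_(i <- s | Q i) dot x (f i).
Proof. by rewrite dotC dot_suml; apply: eq_bigr => i _; exact: dotC. Qed.

Lemma dot_ext x y : (forall z, dot x z = dot y z) -> x = y.
Proof.
move=> xy; apply/eqP; rewrite -subr_eq0; apply/eqP/(dot_eq0 ip).
by rewrite dotDl dotNl xy subrr.
Qed.

Lemma sqrB x y : dot (x - y) (x - y) = dot x x - 2 * dot x y + dot y y.
Proof. rewrite dotDl dotNl !dotDr !dotNr (dotC y x); ring. Qed.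

Lemma sqrD_le x y : dot (x + y) (x + y) <= 2 * (dot x x + dot y y).
Proof.
have := dot_ge0 (x - y); rewrite sqrB dotDl !dotDr (dotC y x); lra.
Qed.

(** A triangle inequality for squared distances: the price for avoiding square roots is the constant
    2, and later the quarters of epsilon. *)
Lemma sqrB_le z x y : 
  dot (x - y) (x - y) <= 2 * (dot (x - z) (x - z) + dot (y - z) (y - z)).
Proof.
have -> : x - y = (x - z) + (z - y) by rewrite addrA subrK.
apply: le_trans (sqrD_le _ _) _.
by rewrite -(opprB y z) dotNl dotNr opprK.
Qed.

Lemma cauchy_schwarz x y : dot x y ^+ 2 <= dot x x * dot y y.
Proof.
have [yy0|yy0] := eqVneq (dot y y) 0.
  by rewrite (dot_eq0 ip yy0) !dot0r mulr0 expr0n.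
have yy : 0 < dot y y by rewrite lt_neqAle eq_sym yy0 dot_ge0.
have := dot_ge0 (x - (dot x y / dot y y) *: y).
rewrite sqrB dotZr dotZr dotZl => h.
rewrite -(ler_pM2r (x := (dot y y)^-1)) ?invr_gt0// mulfK//.
rewrite -subr_ge0; apply: le_trans h _; rewrite le_eqVlt; apply/orP; left.
by apply/eqP; field.
Qed.

Lemma dot_le_sqrt x y : `|dot x y| <= Num.sqrt (dot x x) * Num.sqrt (dot y y).
Proof.
rewrite -sqrtrM ?dot_ge0// -(sqrtr_sqr (dot x y)).
by rewrite ler_wsqrtr// cauchy_schwarz.
Qed.

Lemma dot_lt x y (c : R) : dot x x < c -> dot y y < c -> dot x y < c.
Proof. by move=> xc yc; have := dot_ge0 (x - y); rewrite sqrB; lra. Qed.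

(** The filter is arbitrary because limits are taken both along the integers and along the finite
    sets directed by inclusion. *)
Definition hlim (J : Type) (Phi : set_system J) (u : J -> V) x : Prop :=
  forall e : R, 0 < e -> \forall j \near Phi, dot (u j - x) (u j - x) < e.

Section limits.
Context (J : Type) (Phi : set_system J) {FF : ProperFilter Phi}.
Implicit Types u v : J -> V.

Lemma hlim_unique u x y : hlim Phi u x -> hlim Phi u y -> x = y.
Proof.
move=> ux uy; apply/eqP; rewrite -subr_eq0; apply/eqP/(dot_eq0 ip)/eqP.
rewrite eq_le dot_ge0 andbT; apply/ler_addgt0Pl => e e0; rewrite addr0.
have e4 : 0 < e / 4 by rewrite divr_gt0.
have [j [h1 h2]] : exists j, dot (u j - x) (u j - x) < e / 4 /\
    dot (u j - y) (u j - y) < e / 4.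
  by apply: (@filter_ex _ Phi); apply: filterI; [exact: ux|exact: uy].
apply: le_trans (sqrB_le (u j) x y) _.
rewrite -(opprB (u j) x) -(opprB (u j) y) !(dotNl, dotNr) !opprK; lra.
Qed.

Lemma hlim_cst x : hlim Phi (fun=> x) x.
Proof. by move=> e e0; near=> j; rewrite subrr dot0l. Unshelve. all: by end_near. Qed.

Lemma hlim_near u v x : (\forall j \near Phi, u j = v j) ->
  hlim Phi u x -> hlim Phi v x.
Proof.
by move=> uv ux e e0; apply: filterS2 uv (ux _ e0) => j ->.
Qed.

Lemma hlim_le u v x y :
  (forall j, dot (v j - y) (v j - y) <= dot (u j - x) (u j - x)) ->
  hlim Phi u x -> hlim Phi v y.
Proof.
move=> uv ux e e0; have := ux _ e0.
by apply: filterS => j; exact: le_lt_trans.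
Qed.

Lemma hlimD u v x y : hlim Phi u x -> hlim Phi v y ->
  hlim Phi (fun j => u j + v j) (x + y).
Proof.
move=> ux vy e e0; have e4 : 0 < e / 4 by rewrite divr_gt0.
apply: filterS2 (ux _ e4) (vy _ e4) => j h1 h2.
rewrite opprD addrACA; apply: le_lt_trans (sqrD_le _ _) _; lra.
Qed.

Lemma hlimZ a u x : hlim Phi u x -> hlim Phi (fun j => a *: u j) (a *: x).
Proof.
move=> ux e e0; have [->|a0] := eqVneq a 0.
  by near=> j; rewrite !scale0r subr0 dot0l.
have a2 : 0 < a ^+ 2 by rewrite exprn_even_gt0.
apply: filterS (ux _ (divr_gt0 e0 a2)) => j.
by rewrite -scalerBr dotZl dotZr mulrA -expr2 ltr_pdivlMr// mulrC.
Unshelve. all: by end_near. Qed.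

Lemma hlim_dot u x y : hlim Phi u x -> dot (u j) y @[j --> Phi] --> dot x y.
Proof.
move=> ux; apply/cvgrPdist_lt => e e0.
have yy : 0 < dot y y + 1 by rewrite ltr_wpDl ?dot_ge0.
have e2 : 0 < e ^+ 2 / (dot y y + 1) by rewrite divr_gt0 ?exprn_gt0.
apply: filterS (ux _ e2) => j uj.
rewrite distrC -dotNl -dotDl -(@ltr_pXn2r _ 2)// ?nnegrE ?(ltW e0)//.
rewrite -normrX ger0_norm ?sqr_ge0//; apply: le_lt_trans (cauchy_schwarz _ _) _.
apply: (@le_lt_trans _ _ (dot (u j - x) (u j - x) * (dot y y + 1))).
  by rewrite ler_wpM2l ?dot_ge0// lerDl.
by rewrite -ltr_pdivlMr.
Qed.

Lemma hlim_dot_eq u v x y a b : (forall j, dot (u j) a = dot (v j) b) ->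
  hlim Phi u x -> hlim Phi v y -> dot x a = dot y b.
Proof.
move=> uv ux vy; have := hlim_dot (y := b) vy.
have -> : (fun j => dot (v j) b) = (fun j => dot (u j) a) by exact/funext.
by apply: norm_cvg_unique; exact: hlim_dot.
Qed.

Lemma hlim_sqr u x : hlim Phi u x -> dot (u j) (u j) @[j --> Phi] --> dot x x.
Proof.
move=> ux.
have h1 : dot (u j - x) (u j - x) @[j --> Phi] --> (0 : R).
  apply/cvgrPdist_lt => e e0; apply: filterS (ux _ e0) => j.
  by rewrite sub0r normrN ger0_norm ?dot_ge0.
have h2 : dot (u j - x) x *+ 2 @[j --> Phi] --> (0 : R).
  rewrite -[0](mul0rn _ 2%N) -(subrr (dot x x)).
  apply: cvgMn; under eq_fun do rewrite dotDl dotNl.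
  by apply: cvgB; [exact: hlim_dot|exact: cvg_cst].
have -> : (fun j => dot (u j) (u j)) =
    (fun j => dot (u j - x) (u j - x) + dot (u j - x) x *+ 2 + dot x x).
  apply/funext => j; rewrite -{1 2}(subrK x (u j)).
  move: (u j - x) => y; rewrite dotDl !dotDr (dotC x y) mulr2n; ring.
have := cvgD (cvgD h1 h2) (cvg_cst (dot x x)).
by rewrite !add0r; apply.
Qed.

End limits.

End inner_product.

Section hoeffding_space.
Context (R : realType) (V : lmodType R) (dot : V -> V -> R)
  (E : set nat -> V -> V).

(** [E A] stands for the conditional expectation given F_A. Linearity is not a field: it follows
    from symmetry tested on every vector. Idempotence is [projI] with equal sets. *)
Record hoeffding_space : Prop := HoeffdingSpace {
  hs_inner : inner_product dot;
  hs_complete : forall u : nat -> V,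
    (forall e : R, 0 < e -> exists n, forall m, (n <= m)%N ->
      dot (u m - u n) (u m - u n) < e) -> exists x, hlim dot \oo u x;
  projI : forall A B x, E A (E B x) = E (A `&` B) x;
  proj_sym : forall A x y, dot (E A x) y = dot x (E A y);
  projT : forall x, E setT x = x;
  proj_lim : forall x, hlim dot \oo (fun n => E `I_n x) x }.

Context (hs : hoeffding_space).
Let ip := hs_inner hs.
Let projI := projI hs.
Let proj_sym := proj_sym hs.
Implicit Types (x y z : V) (A B : set nat) (M K : {fset nat}).

Lemma projD A x y : E A (x + y) = E A x + E A y.
Proof.
by apply: (dot_ext ip) => z; rewrite proj_sym !(dotDl ip) !proj_sym.
Qed.

Lemma projZ A a x : E A (a *: x) = a *: E A x.
Proof.
by apply: (dot_ext ip) => z; rewrite proj_sym !(dotZl ip) proj_sym.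
Qed.

Lemma proj0 A : E A 0 = 0.
Proof. by rewrite -(scale0r 0) projZ !scale0r. Qed.

Lemma projN A x : E A (- x) = - E A x.
Proof. by rewrite -scaleN1r projZ scaleN1r. Qed.

Lemma proj_sum (I : Type) (s : seq I) (Q : pred I) (f : I -> V) A :
  E A (\sum_(i <- s | Q i) f i) = \sum_(i <- s | Q i) E A (f i).
Proof. by elim/big_rec2: _ => [|i y1 y2 _ <-]; [exact: proj0|exact: projD]. Qed.

Lemma proj_sqr A x : dot (E A x) (E A x) = dot (E A x) x.
Proof. by rewrite proj_sym projI setIid -proj_sym. Qed.

Lemma proj_dist A x : dot (x - E A x) (x - E A x) = dot x x - dot (E A x) (E A x).
Proof. rewrite (sqrB ip) proj_sqr (dotC ip x); ring. Qed.

Lemma proj_le A x : dot (E A x) (E A x) <= dot x x.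
Proof. by rewrite -subr_ge0 -proj_dist (dot_ge0 ip). Qed.

Definition comp M x : V := moebius (fun K => E [set` K] x) M.

Definition dmal k x : V := x - E [set j | j <> k] x.

Lemma proj_comp A M x : [set` M] `<=` A -> E A (comp M x) = comp M x.
Proof.
move=> MA; rewrite /comp /moebius proj_sum !big_seq; apply: eq_bigr => K.
rewrite fpowersetE => KM; rewrite projZ projI setIidr// => i /= iK.
exact/MA/(fsubsetP KM).
Qed.

(** Applying [E A] turns the component into the Moebius transform of a family that depends on K only
    through its intersection with A. That family does not see k, so the difference in direction k
    vanishes. *)
Lemma proj_comp0 A k M x : k \in M -> ~ A k -> E A (comp M x) = 0.
Proof.
move=> kM Ak; rewrite -[LHS](_ : moebius (fun K => E (A `&` [set` K]) x) M = _).
  apply: moebius_eq0 kM _ => K; congr (E _ x); apply/seteqP; split=> j [Aj] /=.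
    by rewrite !inE => /orP[/eqP jk|//]; rewrite jk in Aj.
  by move=> jK; split=> //=; rewrite !inE jK orbT.
rewrite /comp /moebius proj_sum; apply: eq_bigr => K _.
by rewrite projZ projI.
Qed.

Lemma compD M x y : comp M (x + y) = comp M x + comp M y.
Proof.
by rewrite /comp /moebius -big_split; apply: eq_bigr => K _; rewrite projD scalerDr.
Qed.

Lemma compZ M a x : comp M (a *: x) = a *: comp M x.
Proof.
rewrite /comp /moebius scaler_sumr; apply: eq_bigr => K _.
by rewrite projZ !scalerA mulrC.
Qed.

Lemma comp0 M : comp M 0 = 0.
Proof. by rewrite -(scale0r 0) compZ !scale0r. Qed.

Lemma compN M x : comp M (- x) = - comp M x.
Proof. by rewrite -scaleN1r compZ scaleN1r. Qed.

Lemma comp_sum (I : Type) (s : seq I) (Q : pred I) (f : I -> V) M :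
  comp M (\sum_(i <- s | Q i) f i) = \sum_(i <- s | Q i) comp M (f i).
Proof. by elim/big_rec2: _ => [|i y1 y2 _ <-]; [exact: comp0|exact: compD]. Qed.

Lemma comp_sym M x y : dot (comp M x) y = dot x (comp M y).
Proof.
rewrite (dot_suml ip) (dot_sumr ip); apply: eq_bigr => K _.
by rewrite (dotZl ip) (dotZr ip) proj_sym.
Qed.

Lemma comp_proj M A x : comp M (E A x) = E A (comp M x).
Proof.
by apply: (dot_ext ip) => z; rewrite comp_sym !proj_sym comp_sym; congr dot;
  rewrite /comp /moebius proj_sum; apply: eq_bigr => K _;
  rewrite projZ !projI setIC.
Qed.

(** Of two distinct sets, one is not contained in the other, say L in N. The component at N is fixed
    by the projection of index N, which kills the component at L. *)
Lemma comp_orth M K x y : M != K -> dot (comp M x) (comp K y) = 0.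
Proof.
move=> MK; suff {MK} key L N u v : ~~ (L `<=` N)%fset ->
    dot (comp L u) (comp N v) = 0.
  have [MK'|/key//] := boolP (M `<=` K)%fset.
  rewrite (dotC ip); apply: key; apply: contra MK => KM.
  by rewrite eqEfsubset MK'.
move=> /fsubsetPn[k kL kN]; rewrite -[comp N v](@proj_comp [set` N])//.
by rewrite -proj_sym (proj_comp0 _ kL) ?(dot0l ip)//; exact/negP.
Qed.

(** For equal indices only the top term of the Moebius sum survives, since a proper subset of M
    misses some element of M and its projection kills the component. *)
Lemma comp_comp M K x : comp K (comp M x) = if K == M then comp M x else 0.
Proof.
case: ifP => [/eqP->|/negbT KM]; last first.
  by apply: (dot_ext ip) => z; rewrite comp_sym comp_orth ?(dot0l ip)// eq_sym.
rewrite {1}/comp /moebius (big_fsetD1 M)/= ?fpowersetE//=.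
rewrite subnn scale1r proj_comp// big1_seq ?addr0// => L /andP[_].
rewrite !inE fpowersetE => /andP[LM LsM].
have [k kM kL] : exists2 k, k \in M & k \notin L.
  by apply/fsubsetPn; apply: contra LM => ML; rewrite eqEfsubset LsM.
by rewrite (@proj_comp0 _ k) ?scaler0//; exact/negP.
Qed.

Definition box n : {fset nat} := [fset i in iota 0 n]%fset.

Lemma in_box n i : (i \in box n) = (i < n)%N.
Proof. by rewrite !inE mem_iota add0n leq0n. Qed.

Lemma box_set n : [set` box n] = `I_n.
Proof. by apply/seteqP; split=> i /=; rewrite in_box. Qed.

Lemma sub_box M : exists n, (M `<=` box n)%fset.
Proof.
exists (\max_(i <- M) i).+1; apply/fsubsetP => i iM.
by rewrite in_box ltnS (@leq_bigmax_seq _ (enum_fset M) xpredT id i iM).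
Qed.

Lemma box_le n m : (n <= m)%N -> (box n `<=` box m)%fset.
Proof.
move=> nm; apply/fsubsetP => i; rewrite !in_box => /leq_trans; exact.
Qed.

Lemma sum_comp n x : \sum_(M <- fpowerset (box n)) comp M x = E `I_n x.
Proof. by rewrite sum_moebius box_set. Qed.

Lemma sqr_sum_comp (c : {fset nat} -> R) (B : {fset {fset nat}}) x :
  let y := \sum_(M <- B) c M *: comp M x in
  dot y y = \sum_(M <- B) c M ^+ 2 * dot (comp M x) (comp M x).
Proof.
move=> y; rewrite (dot_suml ip) !big_seq; apply: eq_bigr => M MB.
rewrite (dotZl ip) (dot_sumr ip) (big_fsetD1 M)//= big1_seq ?addr0.
  by rewrite (dotZr ip) mulrA expr2.
move=> K /andP[_]; rewrite !inE => /andP[KM _].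
by rewrite (dotZr ip) comp_orth ?mulr0// eq_sym.
Qed.

Lemma sqr_proj n x : dot (E `I_n x) (E `I_n x) =
  \sum_(M <- fpowerset (box n)) dot (comp M x) (comp M x).
Proof.
have := sqr_sum_comp (fun=> 1) (fpowerset (box n)) x.
under eq_bigr do rewrite scale1r.
rewrite sum_comp => ->; by under eq_bigr do rewrite expr1n mul1r.
Qed.

(** On each box the squared norm is a finite sum over components, by Pythagoras, and the boxes
    exhaust the space. This reduces norm bounds to componentwise bounds. *)
Lemma le_sqr_comp x y :
  (forall M, dot (comp M x) (comp M x) <= dot (comp M y) (comp M y)) ->
  dot x x <= dot y y.
Proof.
move=> xy; apply: (ler_cvg_to (hlim_sqr ip (proj_lim hs x))
  (hlim_sqr ip (proj_lim hs y))).
by apply: nearW => n; rewrite !sqr_proj ler_sum.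
Qed.

Lemma comp_inj x y : (forall M, comp M x = comp M y) -> x = y.
Proof.
move=> xy; apply/eqP; rewrite -subr_eq0; apply/eqP/(dot_eq0 ip)/eqP.
rewrite eq_le (dot_ge0 ip) andbT -(dot0l ip 0) le_sqr_comp// => M.
by rewrite compD compN xy subrr comp0.
Qed.

Lemma comp_projE n M x : comp M (E `I_n x) =
  if (M `<=` box n)%fset then comp M x else 0.
Proof.
rewrite comp_proj; case: ifPn => [Mn|/fsubsetPn[k kM kn]].
  by rewrite proj_comp// -box_set => i /=; exact: (fsubsetP Mn).
by rewrite (proj_comp0 _ kM)// -box_set; exact/negP.
Qed.

Lemma comp_subproj n M x : comp M (x - E `I_n x) =
  if (M `<=` box n)%fset then 0 else comp M x.
Proof.
by rewrite compD compN comp_projE; case: ifP; rewrite (subrr, subr0).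
Qed.

Lemma near_seq (J : Type) (Phi : set_system J) {FF : Filter Phi} (I : eqType)
    (s : seq I) (Q : I -> J -> Prop) : (forall i, \forall j \near Phi, Q i j) ->
  \forall j \near Phi, forall i, i \in s -> Q i j.
Proof.
move=> PhiQ; elim: s => [|i s IH]; first exact: nearW.
apply: filterS2 (PhiQ i) IH => j Qi Qs k.
by rewrite inE => /orP[/eqP->//|]; exact: Qs.
Qed.

(** A dominated convergence principle for components: outside a large box the error is at most the
    tail of y, and the finitely many components inside the box eventually agree with those of x. *)
Lemma hlim_comp0 (J : Type) (Phi : set_system J) {FF : Filter Phi}
    (u : J -> V) x y :
  (forall j M, dot (comp M (u j - x)) (comp M (u j - x)) <=
     dot (comp M y) (comp M y)) ->
  (forall M, \forall j \near Phi, comp M (u j) = comp M x) ->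
  hlim dot Phi u x.
Proof.
move=> uy ux e e0.
have [n _ /(_ n (leqnn n)) yn] := proj_lim hs y e0.
apply: filterS (near_seq (fpowerset (box n)) ux) => j uj.
have pj : E `I_n (u j - x) = 0.
  rewrite -sum_comp big_seq big1// => M /uj uM.
  by rewrite compD compN uM subrr.
have -> : u j - x = (u j - x) - E `I_n (u j - x) by rewrite pj subr0.
move: yn; rewrite -(opprB y) (dotNl ip) (dotNr ip) opprK; apply: le_lt_trans.
apply: le_sqr_comp => M; rewrite !comp_subproj.
by case: ifP => // _; rewrite (dot0l ip) (dot_ge0 ip).
Qed.

Lemma hlim_comp (u : nat -> V) x M : hlim dot \oo u x ->
  hlim dot \oo (fun n => comp M (u n)) (comp M x).
Proof.
move=> ux; apply: hlim_le ux => n; rewrite -compN -compD.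
apply: le_sqr_comp => K; rewrite comp_comp; case: ifP => [/eqP->//|_].
by rewrite (dot0l ip) (dot_ge0 ip).
Qed.

(** The partial sums over boxes form a martingale: projecting a later one gives back an earlier one.
    Their squared norms increase and are bounded by C, and the squared distance of two of them is
    the difference of their squared norms, so they are Cauchy. *)
Lemma multiplier_ex (c : {fset nat} -> R) x (C : R) :
  (forall n, \sum_(M <- fpowerset (box n))
     c M ^+ 2 * dot (comp M x) (comp M x) <= C) ->
  exists y, forall M, comp M y = c M *: comp M x.
Proof.
move=> sC; pose u n := \sum_(M <- fpowerset (box n)) c M *: comp M x.
have uM n M : comp M (u n) = if (M `<=` box n)%fset then c M *: comp M x else 0.
  rewrite comp_sum; case: ifPn => [Mn|Mn].
    rewrite (big_fsetD1 M)/= ?fpowersetE// compZ comp_comp eqxx.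
    rewrite big1_seq ?addr0// => K /andP[_]; rewrite !inE => /andP[KM _].
    by rewrite compZ comp_comp eq_sym (negbTE KM) scaler0.
  rewrite big1_seq// => K /andP[_]; rewrite fpowersetE => Kn.
  rewrite compZ comp_comp; case: eqP => [MK|]; last by rewrite scaler0.
  by rewrite MK Kn in Mn.
have uE n m : (n <= m)%N -> E `I_n (u m) = u n.
  move=> nm; apply: comp_inj => M; rewrite comp_projE !uM.
  by case: ifPn => // Mn; rewrite (fsubset_trans Mn (box_le nm)).
pose s n := dot (u n) (u n).
have s_nd : nondecreasing_seq s.
  by move=> n m nm; rewrite /s -(uE _ _ nm); exact: proj_le.
have s_cvg : cvgn s.
  apply: nondecreasing_is_cvgn => //; exists C => _ [n _ <-].
  by rewrite /s sqr_sum_comp.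
have [x0 y0] : exists y, hlim dot \oo u y.
  apply: (hs_complete hs) => e e0.
  have /cvgrPdist_lt/(_ e e0)[n _ sn] := s_cvg.
  exists n => m nm; rewrite -(uE _ _ nm) proj_dist uE//; apply: le_lt_trans (sn n (leqnn n)).
  rewrite ger0_norm ?subr_ge0; last exact: nondecreasing_cvgn_le.
  by rewrite lerB//; exact: nondecreasing_cvgn_le.
exists x0 => M; apply: (hlim_unique ip (hlim_comp M y0)).
have [n Mn] := sub_box M; apply: (hlim_near _ (hlim_cst ip _)).
exists n => // m /= nm.
by rewrite uM (fsubset_trans Mn (box_le nm)).
Qed.

Lemma comp_dmal M k x : comp M (dmal k x) = if k \in M then comp M x else 0.
Proof.
rewrite /dmal compD compN comp_proj; case: ifPn => kM.
  by rewrite (proj_comp0 _ kM) ?subr0// => /(_ erefl).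
rewrite proj_comp ?subrr// => j /= jM jk.
by rewrite -jk jM in kM.
Qed.

Lemma dmalD k x y : dmal k (x + y) = dmal k x + dmal k y.
Proof. by rewrite /dmal projD opprD addrACA. Qed.

Lemma dmalN k x : dmal k (- x) = - dmal k x.
Proof. by rewrite /dmal projN opprD. Qed.

Lemma dmal_sym k x y : dot (dmal k x) y = dot x (dmal k y).
Proof.
by rewrite /dmal (dotDl ip) (dotDr ip) (dotNl ip) (dotNr ip) proj_sym.
Qed.

Lemma dmalK k x : dmal k (dmal k x) = dmal k x.
Proof. by apply: comp_inj => M; rewrite !comp_dmal; case: ifP => // ->. Qed.

Lemma dmal_le k x : dot (dmal k x) (dmal k x) <= dot x x.
Proof.
apply: le_sqr_comp => M; rewrite comp_dmal; case: ifP => // _.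
by rewrite (dot0l ip) (dot_ge0 ip).
Qed.

Lemma sum_card_le M n : (\sum_(k < n) ((k : nat) \in M) <= #|` M|)%N.
Proof.
rewrite -(big_mkord xpredT (fun k => (k \in M) : nat)) -[X in (X <= _)%N]big_mkcond/=.
rewrite sum1_count -size_filter; apply: uniq_leq_size.
  by rewrite filter_uniq// iota_uniq.
by move=> i; rewrite mem_filter => /andP[].
Qed.

Lemma sum_card M n : (M `<=` box n)%fset ->
  (\sum_(k < n) ((k : nat) \in M))%N = #|` M|.
Proof.
move=> Mn; apply/eqP; rewrite eqn_leq sum_card_le/=.
rewrite -(big_mkord xpredT (fun k => (k \in M) : nat)) -[X in (_ <= X)%N]big_mkcond/=.
rewrite sum1_count -size_filter; apply: uniq_leq_size; first exact: fset_uniq.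
move=> i iM; rewrite mem_filter [X in X && _]iM/= mem_index_iota/= -in_box.
exact: (fsubsetP Mn).
Qed.

Definition mdiv n x : V := \sum_(k < n) dmal k x.

Lemma comp_mdiv M n x :
  comp M (mdiv n x) = (\sum_(k < n) ((k : nat) \in M))%N%:R *: comp M x.
Proof.
rewrite /mdiv comp_sum natr_sum scaler_suml; apply: eq_bigr => k _.
by rewrite comp_dmal; case: ifP; rewrite (scale1r, scale0r).
Qed.

(** D_k is symmetric and idempotent. This finite integration by parts links the pairing of gradients
    with the partial sums of the D_k. *)
Lemma dot_mdiv n x y :
  \sum_(k < n) dot (dmal k x) (dmal k y) = dot x (mdiv n y).
Proof.
rewrite (dot_sumr ip); apply: eq_bigr => k _; by rewrite dmal_sym dmalK.
Qed.

(** The graph of the number operator. It is a relation because the operator is unbounded; y is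
    determined by x through [comp_inj]. *)
Definition number_op x y := forall M, comp M y = #|` M|%:R *: comp M x.

Lemma number_ex (C : R) x :
  (forall n, \sum_(M <- fpowerset (box n))
     #|` M|%:R ^+ 2 * dot (comp M x) (comp M x) <= C) ->
  exists y, number_op x y.
Proof. exact: multiplier_ex. Qed.

(** The error multiplies the component at M by the number of elements of M that are at least n. This
    lies between 0 and |M|, so y itself dominates, and it is 0 once M lies below n. *)
Lemma mdiv_lim x y : number_op x y -> hlim dot \oo (mdiv^~ x) y.
Proof.
move=> xy; apply: (@hlim_comp0 _ _ _ _ _ y).
  move=> n M; rewrite compD compN comp_mdiv xy -scalerBl.
  rewrite !(dotZl ip) !(dotZr ip) !mulrA ler_wpM2r ?(dot_ge0 ip)//.
  rewrite -!expr2 -sqrrN ler_sqr ?nnegrE// opprB.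
    by rewrite gerBl.
  by rewrite subr_ge0 ler_nat sum_card_le.
move=> M; have [n Mn] := sub_box M; exists n => // m /= nm.
by rewrite comp_mdiv xy sum_card// (fsubset_trans Mn (box_le nm)).
Qed.

(** On components inside box n the n-th partial sum already carries the full factor |M|, and
    discarding the other components does not increase the norm. *)
Lemma mdiv_bounded (C : R) x : (forall n, dot (mdiv n x) (mdiv n x) <= C) ->
  forall n, \sum_(M <- fpowerset (box n))
     #|` M|%:R ^+ 2 * dot (comp M x) (comp M x) <= C.
Proof.
move=> xC n; apply: le_trans (xC n); apply: le_trans (proj_le `I_n _).
rewrite sqr_proj !big_seq; apply: ler_sum => M; rewrite fpowersetE => Mn.
by rewrite comp_mdiv sum_card// (dotZl ip) (dotZr ip) mulrA.
Qed.

(* Testing with [y = \sum_(M <= n) |M| x_M], for which both [dot y y] and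
   [\sum_k dot (dmal k y) (dmal k x)] equal [\sum_(M <= n) |M|^2 dot x_M x_M]. *)
Lemma adjoint_bounded (C : R) x : 0 <= C ->
  (forall n y, E `I_n y = y ->
     dot y (mdiv n x) <= C * Num.sqrt (dot y y)) ->
  forall n, \sum_(M <- fpowerset (box n))
     #|` M|%:R ^+ 2 * dot (comp M x) (comp M x) <= C ^+ 2.
Proof.
move=> C0 xC n; set y := \sum_(M <- fpowerset (box n)) #|` M|%:R *: comp M x.
have Ey : E `I_n y = y.
  rewrite /y proj_sum !big_seq; apply: eq_bigr => M; rewrite fpowersetE => Mn.
  by rewrite projZ proj_comp// -box_set => i; exact: (fsubsetP Mn).
have -> : \sum_(M <- fpowerset (box n))
     #|` M|%:R ^+ 2 * dot (comp M x) (comp M x) = dot y y.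
  by rewrite sqr_sum_comp.
have yy : dot y y = dot y (mdiv n x).
  rewrite sqr_sum_comp (dot_suml ip) !big_seq; apply: eq_bigr => M.
  rewrite fpowersetE => Mn; rewrite (dotZl ip) ![dot (comp M x) _]comp_sym comp_mdiv sum_card//.
  by rewrite (dotZr ip) comp_comp eqxx expr2 mulrA.
have := xC n y Ey; rewrite -yy.
have [->|y0] := eqVneq (dot y y) 0; first by rewrite sqr_ge0.
have {y0}y0 : 0 < dot y y by rewrite lt_neqAle eq_sym y0 (dot_ge0 ip).
rewrite -{1}(sqr_sqrtr (ltW y0)) expr2 ler_pM2r ?sqrtr_gt0// => yC.
by rewrite -(sqr_sqrtr (ltW y0)) ler_sqr ?nnegrE ?sqrtr_ge0.
Qed.

Lemma number_subproj n x y : number_op x y ->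
  number_op (x - E `I_n x) (y - E `I_n y).
Proof.
by move=> xy M; rewrite !comp_subproj xy; case: ifP; rewrite ?scaler0.
Qed.

Lemma number_smooth n x : E `I_n x = x -> number_op x (mdiv n x).
Proof.
move=> Ex M; rewrite comp_mdiv; case: (boolP (M `<=` box n)%fset) => Mn.
  by rewrite sum_card.
by rewrite -Ex comp_projE (negbTE Mn) !scaler0.
Qed.

Lemma mdiv_smooth n m x : E `I_n x = x -> (n <= m)%N -> mdiv m x = mdiv n x.
Proof.
move=> Ex nm; apply: comp_inj => M; rewrite !comp_mdiv.
case: (boolP (M `<=` box n)%fset) => Mn.
  by rewrite !sum_card// (fsubset_trans Mn (box_le nm)).
by rewrite -Ex comp_projE (negbTE Mn) !scaler0.
Qed.

Lemma mdiv_sym n x y : dot (mdiv n x) y = dot x (mdiv n y).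
Proof.
rewrite (dot_suml ip) (dot_sumr ip); apply: eq_bigr => k _; exact: dmal_sym.
Qed.

(** The energy identity: the squared norm of the gradient is the pairing of x with its image under
    the number operator. *)
Lemma dmal_series_nneseries x y : number_op x y ->
  (\sum_(0 <= k <oo) (dot (dmal k x) (dmal k x))%:E = (dot x y)%:E)%E.
Proof.
move=> xy; apply/cvg_lim => //.
rewrite (_ : (fun n => _) = EFin \o (fun m => dot (mdiv m x) x)); last first.
  apply/funext => m; rewrite sumEFin /= (dotC ip _ x) -dot_mdiv.
  by rewrite big_mkord.
rewrite (dotC ip x); apply: cvg_EFin; first exact: nearW.
exact: hlim_dot (mdiv_lim xy).
Qed.

(** Parseval. One inequality comes from exhausting by boxes, the other from Bessel's inequality for
    an arbitrary finite set of indices. *)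
Lemma sqr_esum x : (dot x x)%:E =
  (\esum_(M in [set: {fset nat}]) (dot (comp M x) (comp M x))%:E)%E.
Proof.
apply/eqP; rewrite eq_le; apply/andP; split.
  have sx : (dot (E `I_n x) (E `I_n x))%:E @[n --> \oo] --> (dot x x)%:E.
    by apply: cvg_EFin; [exact: nearW|exact: (hlim_sqr ip (proj_lim hs x))].
  rewrite -(cvg_lim _ sx)//; apply: lime_le; first by apply/cvg_ex; eexists; exact: sx.
  apply: nearW => n; rewrite sqr_proj -sumEFin; apply: esum_ge.
  exists [set` fpowerset (box n)].
    by split => //; exact: finite_fset.
  by rewrite fsbig_finite//= set_fsetK.
apply: ub_ereal_sup => _ [B [finB _] <-].
rewrite fsbig_finite//= sumEFin lee_fin.
set B' := fset_set B.
have := sqr_sum_comp (fun=> 1) B' x; set y := \sum_(M <- _) _ => /= yy.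
have -> : \sum_(M <- B') dot (comp M x) (comp M x) = dot y y.
  by rewrite yy; apply: eq_bigr => M _; rewrite expr1n mul1r.
apply: le_sqr_comp => M; have -> : comp M y = if M \in B' then comp M x else 0.
  rewrite comp_sum; case: ifPn => MB.
    rewrite (big_fsetD1 M)//= scale1r comp_comp eqxx big1_seq ?addr0// => K /andP[_].
    by rewrite !inE scale1r comp_comp eq_sym => /andP[/negbTE->].
  rewrite big1_seq// => K /andP[_] KB; rewrite scale1r comp_comp.
  by case: eqP => // MK; rewrite MK KB in MB.
by case: ifP => // _; rewrite (dot0l ip) (dot_ge0 ip).
Qed.

End hoeffding_space.

(** * L^2 of a sub-sigma-algebra *)

Section square_integrable.
Context d (T : measurableType d) (R : realType) (P : probability T R).
Implicit Types (f g h : T -> R) (G : set (set T)).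

(** Measurability refers to the sigma-algebra generated by G, while integrals stay on the ambient
    space; thus spaces for nested sigma-algebras are nested sets of functions. *)
Definition L2 G : set (T -> R) := [set f : T -> R |
  measurable_fun [set: g_sigma_algebraType G] f /\
  P.-integrable [set: T] (EFin \o (fun w => f w ^+ 2))].

Definition dotP f g : R := \int[P]_w (f w * g w).

Lemma sub_measurable_fun G f : <<s G >> `<=` measurable ->
  measurable_fun [set: g_sigma_algebraType G] f -> measurable_fun [set: T] f.
Proof.
by move=> sG mf _ B mB; apply: sG; exact: (mf measurableT B mB).
Qed.

Context (G : set (set T)) (sG : <<s G >> `<=` measurable).
Local Notation L2G := (L2 G).

Lemma L2_measurable f : L2G f -> measurable_fun [set: T] f.
Proof. by case=> + _; exact: sub_measurable_fun. Qed.

Lemma L2_mul_integrable f g : L2G f -> L2G g ->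
  P.-integrable [set: T] (EFin \o (fun w => f w * g w)).
Proof.
move=> Lf Lg; have mf := L2_measurable Lf; have mg := L2_measurable Lg.
have iD : P.-integrable [set: T]
    ((EFin \o (fun w => f w ^+ 2)%R) \+ (EFin \o (fun w => g w ^+ 2)%R))%E.
  by apply: integrableD => //; [case: Lf|case: Lg].
apply: le_integrable iD => //.
  by apply/measurable_EFinP; exact: measurable_funM.
move=> w _ /=; rewrite lee_fin normrM [leRHS]ger0_norm ?addr_ge0 ?sqr_ge0//.
rewrite -(real_normK (num_real (f w))) -(real_normK (num_real (g w))).
by have := sqr_ge0 (`|f w| - `|g w|); rewrite sqrrB; have := sqr_ge0 `|f w|;
  have := sqr_ge0 `|g w|; have := normr_ge0 (f w); have := normr_ge0 (g w); nra.
Qed.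

Lemma L2D f g : L2G f -> L2G g -> L2G (f \+ g).
Proof.
move=> Lf Lg; split.
  by apply: measurable_funD; [case: Lf|case: Lg].
have -> : EFin \o (fun w => (f \+ g) w ^+ 2) =
   (((EFin \o (fun w => f w ^+ 2)%R) \+ (EFin \o (fun w => g w ^+ 2)%R)) \+
   ((EFin \o (fun w => f w * g w)%R) \+ (EFin \o (fun w => f w * g w)%R)))%E.
  by apply/funext => w /=; rewrite -!EFinD sqrrD mulr2n; congr EFin; ring.
by apply: integrableD => //; apply: integrableD => //;
  [case: Lf|case: Lg|exact: L2_mul_integrable|exact: L2_mul_integrable].
Qed.

Lemma L2Z a f : L2G f -> L2G (fun w => a * f w).
Proof.
move=> Lf; split; first by apply: measurable_funM => //; case: Lf.
have -> : EFin \o (fun w => (a * f w) ^+ 2) =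
   (fun w => (a ^+ 2)%:E * (EFin \o (fun w => f w ^+ 2)%R) w)%E.
  by apply/funext => w /=; rewrite -EFinM exprMn.
by apply: integrableZl => //; case: Lf.
Qed.

Lemma L2_cst a : L2G (cst a).
Proof.
split; first exact: measurable_cst.
exact: (finite_measure_integrable_cst P (a ^+ 2)).
Qed.

Lemma L2_integrable f : L2G f -> P.-integrable [set: T] (EFin \o f).
Proof.
move=> Lf; have := L2_mul_integrable (L2_cst 1) Lf.
by congr (P.-integrable _ (EFin \o _)); apply/funext => w; rewrite /= mul1r.
Qed.

Lemma L2N f : L2G f -> L2G (fun w => - f w).
Proof.
by move=> /(L2Z (-1)); congr L2; apply/funext => w; rewrite mulN1r.
Qed.

Lemma L2B f g : L2G f -> L2G g -> L2G (f \- g).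
Proof. by move=> Lf /L2N; exact: L2D. Qed.

Lemma L2_sum_closed (I : Type) (s : seq I) (Q : pred I) (u : I -> T -> R) :
  (forall i, Q i -> L2G (u i)) -> L2G (fun w => \sum_(i <- s | Q i) u i w).
Proof.
move=> Lu; elim: s => [|i s IH].
  by under eq_fun do rewrite big_nil; exact: L2_cst.
under eq_fun do rewrite big_cons.
by have [Qi|//] := boolP (Q i); apply: L2D => //; exact: Lu.
Qed.

Lemma L2_indic A : <<s G >> A -> L2G \1_A.
Proof.
move=> GA; split; first exact: measurable_indic.
have -> : EFin \o (fun w => (\1_A w : R) ^+ 2) = EFin \o \1_A.
  by apply/funext => w /=; rewrite indicE; case: (_ \in _); rewrite (expr1n, expr0n).
by apply: integrable_indic; exact: sG.
Qed.

Lemma dotPC f g : dotP f g = dotP g f.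
Proof. by apply: eq_Rintegral => w _; rewrite mulrC. Qed.

Lemma dotPDl f g h : L2G f -> L2G g -> L2G h ->
  dotP (f \+ g) h = dotP f h + dotP g h.
Proof.
move=> Lf Lg Lh; rewrite /dotP -RintegralD//; try exact: L2_mul_integrable.
by apply: eq_Rintegral => w _; rewrite /= mulrDl.
Qed.

Lemma dotPZl a f g : L2G f -> L2G g -> dotP (fun w => a * f w) g = a * dotP f g.
Proof.
move=> Lf Lg; rewrite /dotP -RintegralZl//; try exact: L2_mul_integrable.
by apply: eq_Rintegral => w _; rewrite /= mulrA.
Qed.

Lemma dotP_ge0 f : 0 <= dotP f f.
Proof. by apply: Rintegral_ge0 => w _; rewrite -expr2 sqr_ge0. Qed.

Lemma dotPE f g : L2G f -> L2G g -> (dotP f g)%:E = (\int[P]_w (f w * g w)%:E)%E.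
Proof.
move=> Lf Lg; rewrite /dotP /Rintegral fineK//.
by apply: integrable_fin_num => //; exact: L2_mul_integrable.
Qed.

Lemma dotP_eq0 f : L2G f -> dotP f f = 0 -> f = cst 0 %[ae P].
Proof.
move=> Lf f0; have mf := L2_measurable Lf.
have : (\int[P]_w `|(f w ^+ 2)%:E| = 0)%E.
  under eq_integral do rewrite gee0_abs ?lee_fin ?sqr_ge0//.
  by rewrite -[RHS](congr1 EFin f0) dotPE.
have m2 : measurable_fun [set: T] (fun w => (f w ^+ 2)%:E).
  by apply/measurable_EFinP; exact: measurable_funX.
move/(ae_eq_integral_abs _ measurableT m2).
by apply: filterS => w /= /(_ I) [] /eqP; rewrite sqrf_eq0 => /eqP.
Qed.

Lemma dotP_ae f f' g : L2G f -> L2G f' -> L2G g -> f = f' %[ae P] ->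
  dotP f g = dotP f' g.
Proof.
move=> Lf Lf' Lg ff'; congr fine; apply: ae_eq_integral => //.
- by case/integrableP: (L2_mul_integrable Lf Lg).
- by case/integrableP: (L2_mul_integrable Lf' Lg).
- by apply: filterS ff' => w /(_ I) + _ => ->.
Qed.

End square_integrable.

(** * Completeness of L^2 of a sub-sigma-algebra *)

Section L2_completeness.
Context d (T : measurableType d) (R : realType) (P : probability T R).
Implicit Types (f g h : T -> R).
Context (G : set (set T)) (sG : <<s G >> `<=` measurable).
Local Notation L2G := (L2 P G).
Local Notation dotP := (dotP P).
Local Notation dist f g := (dotP (f \- g) (f \- g)).

Lemma dist_tri g f h : L2G f -> L2G g -> L2G h ->
  dist f h <= 2 * (dist f g + dist h g).
Proof.
move=> Lf Lg Lh.
have i1 a b : L2G a -> L2G b ->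
    P.-integrable [set: T] (EFin \o (fun w => (a \- b) w * (a \- b) w)).
  by move=> La Lb; apply: (L2_mul_integrable sG); exact: (L2B sG).
rewrite /dotP -RintegralD//; try exact: i1.
have iD : P.-integrable [set: T] (EFin \o (fun w =>
    (f \- g) w * (f \- g) w + (h \- g) w * (h \- g) w)).
  rewrite [X in P.-integrable _ X](_ : _ =
    (EFin \o (fun w => (f \- g) w * (f \- g) w)%R) \+
    (EFin \o (fun w => (h \- g) w * (h \- g) w)%R))%E; last exact/funext.
  by apply: integrableD => //; exact: i1.
rewrite -RintegralZl//; apply: le_Rintegral => //; first exact: i1.
  have := integrableZl measurableT 2 iD.
  by congr (P.-integrable _ _); apply/funext => w /=; rewrite EFinM.
move=> w _ /=; rewrite -!expr2.
by have := sqr_ge0 (f w - g w + (h w - g w)); nra.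
Qed.

(** From (|f| - b)^2 >= 0 one gets |f| <= f^2 / (2 b) + b / 2, whose integral is at most b because P
    has mass 1. *)
Lemma L1_le f b : L2G f -> 0 < b -> dotP f f <= b ^+ 2 ->
  (\int[P]_w `|f w|%:E <= b%:E)%E.
Proof.
move=> Lf b0 fb; have mf := L2_measurable sG Lf.
have i1 := L2_mul_integrable sG Lf Lf.
pose h w := (2 * b)^-1 * (f w * f w) + b / 2.
apply: (@le_trans _ _ (\int[P]_w (h w)%:E)%E).
  apply: ge0_le_integral => //.
  - by apply/measurable_EFinP; exact: measurableT_comp.
  - apply/measurable_EFinP; apply: measurable_funD => //.
    by apply: measurable_funM => //; exact: measurable_funM.
  - move=> w _; rewrite lee_fin /h invfM mulrC.
    rewrite -(ler_pM2r b0) mulrDl mulrA !divfK ?gt_eqF//.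
    have := sqr_ge0 (`|f w| - b); rewrite sqrrB real_normK ?num_real// expr2 => h1.
    lra.
pose h1 w := (2 * b)^-1 * (f w * f w).
have ih : P.-integrable [set: T] (EFin \o h1).
  exact: (integrableZl measurableT (2 * b)^-1 i1).
have ib := finite_measure_integrable_cst P (b / 2) measurableT.
rewrite (_ : (fun w => (h w)%:E) = (EFin \o h1) \+ (EFin \o cst (b / 2)%R))%E//.
rewrite integralD//.
have -> : (\int[P]_w (EFin \o cst (b / 2)%R) w = (b / 2)%:E)%E.
  rewrite [LHS](integral_cst P measurableT (b / 2)%:E).
  by rewrite [X in (_ * X)%E](_ : _ = 1%E) ?mule1//; exact: probability_setT.
under eq_integral do rewrite /= EFinM.
rewrite (integralZl measurableT i1) -(dotPE sG Lf Lf) -EFinM -EFinD lee_fin.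
rewrite -(ler_pM2l (x := 2 * b)) ?mulr_gt0// mulrDr mulrA divff ?gt_eqF ?mulr_gt0//.
by rewrite mul1r; lra.
Qed.

(* The limit of a fast subsequence, obtained pointwise as a [limn_esup] so that
   it is measurable for the sub-sigma-algebra. *)
Lemma L2_complete (u : nat -> T -> R) : (forall n, L2G (u n)) ->
  (forall e : R, 0 < e -> exists n, forall m, (n <= m)%N -> dist (u m) (u n) < e) ->
  exists2 f, L2G f & forall e : R, 0 < e -> \forall n \near \oo, dist (u n) f < e.
Proof.
(* The numbers [b k] sum to at most 1. Cauchy at level [b k ^+ 2 / 4] bounds the distance of any two
   later terms by 2 (1/4 + 1/4) [b k ^+ 2], that is [b k ^+ 2]. *)
move=> Lu uC; pose b k : R := 1 / (2 ^ k.+1)%:R.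
have b0 k : 0 < b k by rewrite divr_gt0// ltr0n expn_gt0.
have b20 k : 0 < b k ^+ 2 / 4 by rewrite divr_gt0// exprn_gt0.
have [N hN] := choice (fun k => uC _ (b20 k)).
pose n k := (\max_(i < k.+1) N i)%N.
have Nn k : (N k <= n k)%N by exact: (@leq_bigmax _ (fun i : 'I_k.+1 => N i) ord_max).
have nS k : (n k <= n k.+1)%N.
  by rewrite /n [leqRHS]big_ord_recr/= leq_maxl.
have nn k j : (k <= j)%N -> (n k <= n j)%N.
  by move=> kj; exact: (homo_leq leqnn leq_trans nS).
have uu k m m' : (n k <= m)%N -> (n k <= m')%N -> dist (u m) (u m') <= b k ^+ 2.
  move=> km km'; apply: le_trans (dist_tri (Lu m) (Lu (N k)) (Lu m')) _.
  have h1 := hN k m (leq_trans (Nn k) km).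
  have h2 := hN k m' (leq_trans (Nn k) km'); lra.
pose v k := u (n k).
have Lv k : L2G (v k) by exact: Lu.
pose h k w : \bar R := `|v k.+1 w - v k w|%:E.
have h0 k w : (0 <= h k w)%E by rewrite lee_fin.
have mh k : measurable_fun [set: T] (h k).
  apply/measurable_EFinP; apply: measurableT_comp => //.
  by apply: measurable_funB; exact: (L2_measurable sG).
have ih : (\int[P]_w \sum_(0 <= k <oo) h k w < +oo)%E.
  rewrite integral_nneseries//.
  apply: (@le_lt_trans _ _ (1 : R)%:E); last exact: ltry.
  apply: le_trans (epsilon_trick0 xpredT ler01).
  apply: lee_nneseries => [k _ _|k _]; first exact: integral_ge0.
  apply: (@L1_le (v k.+1 \- v k)) => //; first exact: (L2B sG).
  by apply: uu => //; exact: nn.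
(* The increments have L^1 norms at most [b k], so their absolute values have an almost everywhere
   finite sum and the telescoping series converges. *)
have h_ae : {ae P, forall w, cvgn (fun k => v k w)}.
  have /integrable_ae : P.-integrable [set: T] (fun w => \sum_(0 <= k <oo) h k w)%E.
    apply/integrableP; split; first exact: ge0_emeasurable_sum.
    by under eq_integral do rewrite gee0_abs ?nneseries_ge0//.
  move=> /(_ measurableT); apply: filterS => w /(_ I) hw.
  have hs : cvgn (series (fun k => `|v k.+1 w - v k w|)).
    apply: nnseries_is_cvg => //.
    by move: hw; rewrite fin_numE => /andP[_]; rewrite ltey.
  have /cvg_ex[l vl] := normed_cvg hs.
  apply/cvg_ex; exists (v 0%N w + l).
  rewrite (_ : (fun k => v k w) = (fun k => v 0%N w + series (telescope (v^~ w)) k)).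
    by apply: cvgD vl; exact: cvg_cst.
  by apply/funext => k; exact: eq_sum_telescope.
pose f w := fine (limn_esup (fun k => (v k w)%:E)).
have mfG : measurable_fun [set: g_sigma_algebraType G] f.
  apply: measurableT_comp; first exact: fine_measurable.
  by apply: measurable_fun_limn_esup => k; apply/measurable_EFinP; case: (Lv k).
have mf := sub_measurable_fun sG mfG.
have vf : {ae P, forall w, v k w @[k --> \oo] --> f w}.
  apply: filterS h_ae => w hw.
  have hE : (v k w)%:E @[k --> \oo] --> (limn (v^~ w))%:E.
    by apply: cvg_EFin; [exact: nearW|exact: hw].
  by rewrite /f is_cvg_limn_esupE ?(cvg_lim _ hE)//; apply/cvg_ex; eexists; exact: hE.
(* Fatou's lemma carries the bound on the distance between [v (j + k)] and [v k] to the limit in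
   j. *)
have fv k : (\int[P]_w ((f w - v k w) ^+ 2)%:E <= (b k ^+ 2)%:E)%E.
  pose g j w := ((v (j + k)%N w - v k w) ^+ 2)%:E.
  have mg j : measurable_fun [set: T] (g j).
    apply/measurable_EFinP; apply: measurable_funX; apply: measurable_funB;
    exact: (L2_measurable sG).
  have g0 j w : [set: T] w -> (0 <= g j w)%E by rewrite lee_fin sqr_ge0.
  have -> : (\int[P]_w ((f w - v k w) ^+ 2)%:E = \int[P]_w limn_einf (g^~ w))%E.
    apply: ge0_ae_eq_integral => //.
    - apply/measurable_EFinP; apply: measurable_funX; apply: measurable_funB => //.
      exact: (L2_measurable sG).
    - apply: (emeasurable_fun_cvg (fun n w => einfs (g^~ w) n)).
        by move=> j; exact: measurable_fun_einfs.
      by move=> w _; rewrite limn_einf_lim; exact: is_cvg_einfs.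
    - by move=> w _; rewrite lee_fin sqr_ge0.
    - move=> w _; rewrite limn_einf_lim; apply: lime_ge; first exact: is_cvg_einfs.
      by apply: nearW => j; apply: le_ereal_inf_tmp => _ [m /= _ <-]; exact: g0.
    apply: filterS vf => w vw _.
    have gw : g j w @[j --> \oo] --> ((f w - v k w) ^+ 2)%:E.
      apply: cvg_EFin; first exact: nearW.
      have vkw : v (j + k)%N w @[j --> \oo] --> f w.
        by have := cvg_shiftn k (v^~ w : R^o^nat) (nbhs (f w)); rewrite /= => ->.
      by apply: cvgM; apply: cvgB => //; exact: cvg_cst.
    by rewrite is_cvg_limn_einfE ?(cvg_lim _ gw)//; apply/cvg_ex; eexists; exact: gw.
  apply: le_trans (fatou _ _ _ _) _ => //.
  rewrite limn_einf_lim; apply: lime_le; first exact: is_cvg_einfs.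
  apply: nearW => j; apply: (@le_trans _ _ (\int[P]_w g j w)%E).
    by apply: ereal_inf_lbound; exists j => //=.
  rewrite /g; under eq_integral do rewrite expr2.
  rewrite -(dotPE sG (L2B sG (Lv (j + k)%N) (Lv k)) (L2B sG (Lv (j + k)%N) (Lv k))).
  by rewrite lee_fin; apply: uu => //; apply: nn; exact: leq_addl.
have Lfv k : L2G (f \- v k).
  split; first by apply: measurable_funB => //; case: (Lv k).
  apply/integrableP; split.
    apply/measurable_EFinP; apply: measurable_funX; apply: measurable_funB => //.
    exact: (L2_measurable sG).
  under eq_integral do rewrite /= ger0_norm ?sqr_ge0//.
  exact: le_lt_trans (fv k) (ltry _).
have Lf : L2G f.
  have := L2D sG (Lfv 0%N) (Lv 0%N).
  by congr L2; apply/funext => w /=; rewrite subrK.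
have fv' k : dist f (v k) <= b k ^+ 2.
  rewrite -lee_fin (dotPE sG (Lfv k) (Lfv k)); apply: le_trans (fv k).
  by under eq_integral do rewrite -expr2.
exists f => // e e0.
have [k ke] : exists k, b k ^+ 2 < e / 4.
  have [k] := ltr_add_invr (divr_gt0 e0 (ltr0n R 4)); rewrite add0r => ke.
  exists k; apply: le_lt_trans ke; rewrite /b div1r.
  apply: (@le_trans _ _ ((2 ^ k.+1)%:R^-1)).
    by rewrite expr2 ler_piMr// invf_le1 ?ler1n ?ltr0n expn_gt0.
  by rewrite lef_pV2 ?posrE ?ltr0n ?expn_gt0// ler_nat ltnW// ltn_expl.
exists (n k) => // m /= km.
apply: le_lt_trans (dist_tri (Lu m) (Lv k) Lf) _.
have := fv' k; have := uu k m (n k) km (leqnn _); rewrite -/(v k); lra.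
Qed.

End L2_completeness.

Import HBNNSimple.

(** * Induction on square integrable functions from a pi-system *)

Section L2_density.
Context d (T : measurableType d) (R : realType) (P : probability T R).
Implicit Types (f g h : T -> R).
Context (G : set (set T)) (sG : <<s G >> `<=` measurable).
Local Notation L2G := (L2 P G).
Local Notation dotP := (dotP P).
Local Notation dist f g := (dotP (f \- g) (f \- g)).

Lemma L2_dominated (u : nat -> T -> R) f h : (forall n, L2G (u n)) -> L2G f ->
  L2G h -> (forall w, u n w @[n --> \oo] --> f w) ->
  (forall n w, `|u n w| <= h w) -> (forall w, `|f w| <= h w) ->
  forall e : R, 0 < e -> exists n, dist f (u n) < e.
Proof.
move=> Lu Lf Lh uf uh fh e e0.
have Lfu n : L2G (f \- u n) by exact: (L2B sG).
have mv n : measurable_fun [set: T] (fun w => ((f \- u n) w * (f \- u n) w)%:E).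
  by case/integrableP: (L2_mul_integrable sG (Lfu n) (Lfu n)).
have L2h : L2G (fun w => 2 * h w) by exact: L2Z.
have [|||_ _] := @dominated_convergence _ _ _ P _ measurableT
    (fun n w => ((f \- u n) w * (f \- u n) w)%:E) (cst 0%E)
    (fun w => ((2 * h w) * (2 * h w))%:E) mv (measurable_cst _).
- apply: aeW => w _; apply: cvg_EFin; first exact: nearW.
  have fu0 : (f \- u n) w @[n --> \oo] --> (0 : R).
    by rewrite -(subrr (f w)); apply: cvgB; [exact: cvg_cst|exact: uf].
  by rewrite -(mulr0 (0 : R)); apply: cvgM.
- exact: (L2_mul_integrable sG).
- apply: aeW => w n _ /=; rewrite lee_fin normrM.
  have : `|f w - u n w| <= 2 * h w.
    by apply: le_trans (ler_normB _ _) _; have := uh n w; have := fh w; lra.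
  by move=> ?; rewrite ler_pM.
rewrite integral0 => /fine_cvgP[_ /cvgrPdist_lt/(_ e e0)[n _ /(_ n (leqnn n))]].
rewrite /= sub0r normrN => ne; exists n; apply: le_lt_trans ne.
by rewrite ler_norm.
Qed.

Context (GI : setI_closed G) (GT : G [set: T]) (S : set (T -> R)).
Context (Sind : forall A, G A -> S \1_A)
  (Slin : forall a f g, L2G f -> L2G g -> S f -> S g ->
    S (fun w => a * f w + g w))
  (Scl : forall f, L2G f ->
    (forall e : R, 0 < e -> exists g, [/\ L2G g, S g & dist f g < e]) -> S f).

Lemma L2_ind_sum n (a : nat -> R) (u : nat -> T -> R) :
  (forall i, (i < n)%N -> L2G (u i) /\ S (u i)) ->
  L2G (fun w => \sum_(i < n) a i * u i w) /\ S (fun w => \sum_(i < n) a i * u i w).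
Proof.
elim: n => [|n IH] Su.
  (* [S] is only closed under combinations with one coefficient equal to 1, so zero is obtained as
     the indicator of the whole space minus itself. *)
  have S0 : S (cst 0).
    have := @Slin (-1) _ _ (L2_indic P sG (sub_gen_smallest GT))
      (L2_indic P sG (sub_gen_smallest GT)) (Sind GT) (Sind GT).
    by congr S; apply/funext => w; rewrite indicT/= mulN1r addNr.
  have -> : (fun w => \sum_(i < 0) a i * u i w) = cst 0.
    by apply/funext => w; rewrite big_ord0.
  by split => //; exact: L2_cst.
have [L1 S1] : L2G (fun w => \sum_(i < n) a i * u i w) /\
    S (fun w => \sum_(i < n) a i * u i w).
  by apply: IH => i ni; apply: Su; exact: ltnW.
have [L2' S2] := Su n (ltnSn n).
have -> : (fun w => \sum_(i < n.+1) a i * u i w) =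
    (fun w => a n * u n w + (fun w => \sum_(i < n) a i * u i w) w).
  by apply/funext => w; rewrite big_ord_recr/= addrC.
split; last exact: Slin.
by apply: (L2D sG) => //; exact: L2Z.
Qed.

(** The sets whose indicator satisfies [S] form a Dynkin class: complements by linearity, disjoint
    unions because the finite partial sums are dominated by 1 and converge in L^2. *)
Lemma L2_ind_indic A : <<s G >> A -> S \1_A.
Proof.
apply: (@dynkin_induction _ (g_sigma_algebraType G) G (fun A => S \1_A)) => //.
- exact: Sind.
- move=> B mB SB.
  have := Slin (-1) (L2_indic P sG mB) (L2_indic P sG (sub_gen_smallest GT)) SB (Sind GT).
  congr S; apply/funext => w; rewrite !indicE in_setC in_setT.
  by case: (w \in B); rewrite ?mulr1 ?mulr0 ?add0r// addNr.
- move=> F mF tF SF.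
  have LF i : L2G \1_(F i) by exact: (L2_indic P sG (mF i)).
  have mU : <<s G >> (\bigcup_k F k) by exact: (@bigcup_measurable _ (g_sigma_algebraType G)).
  pose u n w : R := \sum_(i < n) 1 * \1_(F i) w.
  have u_in n w i : (i < n)%N -> F i w -> u n w = 1.
    move=> ni Fi; rewrite /u (bigD1 (Ordinal ni))//= big1 ?addr0.
      by rewrite mul1r indicE mem_set.
    move=> j ji; rewrite mul1r indicE memNset// => Fj.
    move/eqP: ji; apply; apply/val_inj/(@tF j i) => //.
    by exists w.
  have u_out n w : ~ (\bigcup_k F k) w -> u n w = 0.
    move=> Fw; apply: big1 => i _; rewrite mul1r indicE memNset// => Fi.
    by apply: Fw; exists i.
  have u1 n w : `|u n w| <= 1.
    have [Fw|Fw] := pselect (exists2 i, (i < n)%N & F i w).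
      by case: Fw => i ni Fi; rewrite (u_in _ _ _ ni Fi) normr1.
    rewrite /u big1 ?normr0// => i _; rewrite mul1r indicE memNset// => Fi.
    by apply: Fw; exists i.
  have uS n : L2G (u n) /\ S (u n).
    exact: (@L2_ind_sum n (cst 1) (fun i => \1_(F i)) (fun i _ => conj (LF i) (SF i))).
  apply: Scl => [|e e0]; first exact: (L2_indic P sG mU).
  have [n ne] : exists n, dist \1_(\bigcup_k F k) (u n) < e.
    apply: (@L2_dominated u _ (cst 1)) => //.
    - by move=> n; case: (uS n).
    - exact: (L2_indic P sG mU).
    - exact: L2_cst.
    - move=> w; have [[i _ Fi]|Fw] := pselect ((\bigcup_k F k) w).
        apply: cvg_near_cst; exists i.+1 => // n /= ni.
        by rewrite (u_in _ _ _ ni Fi) indicE mem_set//; exists i.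
      apply: cvg_near_cst; apply: nearW => n.
      by rewrite u_out// indicE memNset.
    - by move=> w; rewrite indicE; case: (_ \in _); rewrite ?normr1 ?normr0.
  by exists (u n); split => //; case: (uS n).
Qed.

(** The approximating simple functions are built on the generated sigma-algebra, so their level sets
    are covered by the case of indicators; they are dominated by f. *)
Lemma L2_ind_ge0 f : L2G f -> (forall w, 0 <= f w) -> S f.
Proof.
move=> Lf f0; apply: Scl => // e e0.
have mf : measurable_fun [set: g_sigma_algebraType G] (EFin \o f).
  by apply/measurable_EFinP; case: Lf.
have f0' (w : g_sigma_algebraType G) : [set: g_sigma_algebraType G] w ->
  (0 <= (EFin \o f) w)%E by rewrite lee_fin.
pose a := nnsfun_approx (@measurableT _ (g_sigma_algebraType G)) mf.
pose u n : T -> R := a n.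
have uf w : u n w @[n --> \oo] --> f w.
  have /fine_cvgP[_] := @cvg_nnsfun_approx _ _ _ _ (@measurableT _ (g_sigma_algebraType G)) _ mf f0' w I.
  exact.
have uS n : L2G (u n) /\ S (u n).
  pose s := fset_set (range (a n)).
  have -> : u n = (fun w => \sum_(i < #|` s|) s`_i *
      \1_(a n @^-1` [set s`_i]) w).
    by apply/funext => w; rewrite /u fimfunEord.
  apply: (@L2_ind_sum _ (fun i => s`_i)
     (fun i => \1_(a n @^-1` [set s`_i]))) => i _.
  have mi : <<s G >> (a n @^-1` [set s`_i]).
    exact: (measurable_funPTI (a n) (measurable_set1 _)).
  by split; [exact: (L2_indic P sG mi)|exact: L2_ind_indic].
have uh n w : `|u n w| <= f w.
  rewrite ger0_norm; last exact: fun_ge0.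
  by have := @le_approx _ _ _ _ _ n w f0' I; rewrite -lee_fin /u /a nnsfun_approxE.
have [n ne] : exists n, dist f (u n) < e.
  apply: (@L2_dominated u f f) => //; first by move=> n; case: (uS n).
  by move=> w; rewrite ger0_norm.
by exists (u n); split => //; case: (uS n).
Qed.

Lemma L2_ind f : L2G f -> S f.
Proof.
move=> Lf.
have mG : measurable_fun [set: g_sigma_algebraType G] f by case: Lf.
have key g : measurable_fun [set: g_sigma_algebraType G] g ->
    (forall w, `|g w| <= `|f w|) -> L2G g.
  move=> mg gf; split => //; case: (Lf) => _; apply: le_integrable => //.
    apply/measurable_EFinP; apply: measurable_funX.
    exact: sub_measurable_fun mg.
  by move=> w _ /=; rewrite lee_fin !normrX ler_pXn2r ?nnegrE.
have Lp : L2G (f^\+).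
  apply: key; first exact: measurable_funrpos.
  move=> w; rewrite /funrpos; case: (leP (f w) 0) => fw; rewrite ?normr0//.
have Ln : L2G (f^\-).
  apply: key; first exact: measurable_funrneg.
  move=> w; rewrite /funrneg; case: (leP (- f w) 0) => fw; rewrite ?normr0 ?normrN//.
have := Slin (-1) Ln Lp (L2_ind_ge0 Ln _) (L2_ind_ge0 Lp _).
have -> : (fun w => -1 * f^\- w + f^\+ w) = f.
  by rewrite -[RHS]funrposBneg; apply/funext => w /=; rewrite mulN1r addrC.
by apply => w; rewrite (funrpos_ge0, funrneg_ge0).
Qed.

End L2_density.

(** * The space of classes and its conditional expectations *)

Section L2_space.
Context d (T : measurableType d) (R : realType) (P : probability T R)
  (dE : nat -> measure_display) (E : forall n, measurableType (dE n))
  (X : forall n, {RV P >-> E n}).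
Implicit Types (f g h : T -> R) (A B : set nat).

Lemma rv_sets_measurable A : <<s rv_sets X A >> `<=` measurable.
Proof.
apply: smallest_sub; first exact: sigma_algebra_measurable.
by move=> _ [j _ [C mC <-]]; exact: measurable_funPT.
Qed.

Lemma rv_sets_sub A B : A `<=` B -> <<s rv_sets X A >> `<=` <<s rv_sets X B >>.
Proof.
move=> AB; apply: smallest_sub; first exact: smallest_sigma_algebra.
by move=> C [j Aj XC]; apply: sub_gen_smallest; exists j => //; exact: AB.
Qed.

Definition L2F A := L2 P (rv_sets X A).

Local Notation H := (L2F setT).
Let sH := @rv_sets_measurable setT.

Lemma L2F_sub A B : A `<=` B -> L2F A `<=` L2F B.
Proof.
move=> AB f [mf If]; split=> // _ C mC.
by apply: (rv_sets_sub AB); exact: (mf measurableT C mC).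
Qed.

Lemma L2FT A f : L2F A f -> H f.
Proof. by apply: L2F_sub. Qed.

(* A class modulo almost everywhere equality is represented by the linear form
   [h |-> E(f h)] on square integrable functions, so that equality in [L2space]
   is Leibniz equality and the module structure is that of a space of functions. *)
Definition pairing f : (T -> R) -> R^o :=
  fun h => if `[< H h >] then dotP P f h else 0.

Definition pairings : {pred (T -> R) -> R^o} := mem [set pairing f | f in H].

Lemma pairings_submod_closed : submod_closed pairings.
Proof.
split.
  rewrite inE/=; exists (cst 0); first exact: L2_cst.
  apply/funext => h; rewrite /pairing; case: ifPn => // _.
  by rewrite /dotP; under eq_Rintegral do rewrite mul0r; rewrite Rintegral_cst// mul0r.
move=> a _ _ /[!inE]/= -[f Hf <-] [g Hg <-].
exists ((fun w => a * f w) \+ g); first by apply: (L2D sH) => //; exact: L2Z.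
apply/funext => h; rewrite /pairing !fctE; case: ifPn => [/asboolP Hh|_].
  by rewrite (dotPDl sH)//; [rewrite (dotPZl sH)|exact: L2Z].
by rewrite scaler0 addr0.
Qed.

HB.instance Definition _ :=
  GRing.isSubmodClosed.Build R _ pairings pairings_submod_closed.

Definition L2space := {phi : (T -> R) -> R^o | phi \in pairings}.

HB.instance Definition _ := SubType.on L2space.
HB.instance Definition _ := [Choice of L2space by <:].
HB.instance Definition _ := [SubChoice_isSubLmodule of L2space by <:].

(** The default 0 can only concern functions that are not square integrable, whence the hypothesis
    [H f] in the rules below. *)
Definition cls f : L2space := insubd 0 (pairing f).

Lemma val_cls f : H f -> val (cls f) = pairing f.
Proof. by move=> Hf; rewrite /cls insubdK// inE/=; exists f. Qed.

Definition rep (x : L2space) : T -> R := get [set f | H f /\ pairing f = val x].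

Lemma repP x : H (rep x) /\ pairing (rep x) = val x.
Proof.
apply: (@getPex _ [set f | H f /\ pairing f = val x]).
by have := valP x; rewrite inE/= => -[f Hf fx]; exists f.
Qed.

Lemma rep_L2 x : H (rep x).
Proof. by case: (repP x). Qed.

Lemma repK : cancel rep cls.
Proof. by move=> x; apply: val_inj; rewrite val_cls; case: (repP x). Qed.

Definition dotV (x y : L2space) : R := dotP P (rep x) (rep y).

Lemma dotP_rep_cls f h : H f -> H h -> dotP P (rep (cls f)) h = dotP P f h.
Proof.
move=> Hf Hh; have [_] := repP (cls f); rewrite val_cls// => /(congr1 (@^~ h)).
by rewrite /pairing asboolT.
Qed.

Lemma dotV_cls f g : H f -> H g -> dotV (cls f) (cls g) = dotP P f g.
Proof.
move=> Hf Hg; rewrite /dotV dotP_rep_cls//; last exact: rep_L2.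
by rewrite dotPC dotP_rep_cls// dotPC.
Qed.

Lemma clsD f g : H f -> H g -> cls (f \+ g) = cls f + cls g.
Proof.
move=> Hf Hg; apply: val_inj; rewrite val_cls; last exact: (L2D sH).
rewrite raddfD/= !val_cls//; apply/funext => h; rewrite !fctE /pairing.
by case: ifPn => [/asboolP Hh|_]; rewrite ?(dotPDl sH)// addr0.
Qed.

Lemma clsZ a f : H f -> cls (fun w => a * f w) = a *: cls f.
Proof.
move=> Hf; apply: val_inj; rewrite val_cls; last exact: L2Z.
rewrite linearZ/= !val_cls//; apply/funext => h; rewrite !fctE /pairing.
by case: ifPn => [/asboolP Hh|_]; rewrite ?(dotPZl sH)// scaler0.
Qed.

Lemma clsN f : H f -> cls (fun w => - f w) = - cls f.
Proof.
move=> Hf; rewrite -scaleN1r -clsZ//; congr cls; apply/funext => w.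
by rewrite mulN1r.
Qed.

Lemma clsB f g : H f -> H g -> cls (f \- g) = cls f - cls g.
Proof. by move=> Hf Hg; rewrite -clsN// -clsD//; exact: L2N. Qed.

Lemma cls0 : cls (cst 0) = 0.
Proof.
have H0 : H (cst 0) by exact: L2_cst.
rewrite -(scale0r (cls (cst 0))) -clsZ//; congr cls; apply/funext => w.
by rewrite mul0r.
Qed.

Lemma cls_sum (I : Type) (s : seq I) (Q : pred I) (u : I -> T -> R) :
  (forall i, Q i -> H (u i)) ->
  cls (fun w => \sum_(i <- s | Q i) u i w) = \sum_(i <- s | Q i) cls (u i).
Proof.
move=> Hu; elim: s => [|i s IH].
  rewrite big_nil -cls0; congr cls; apply/funext => w; by rewrite big_nil.
rewrite big_cons; under eq_fun do rewrite big_cons.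
have [Qi|//] := boolP (Q i); rewrite -IH -clsD//; first exact: Hu.
exact: (L2_sum_closed sH).
Qed.

Lemma cls_ae f g : H f -> H g -> f = g %[ae P] -> cls f = cls g.
Proof.
move=> Hf Hg fg; apply: val_inj; rewrite !val_cls//; apply/funext => h.
by rewrite /pairing; case: ifPn => [/asboolP Hh|//]; exact: (dotP_ae sH).
Qed.

Lemma dotV_inner : inner_product dotV.
Proof.
split=> [x y|x y z|a x y|x|x x0].
- exact: dotPC.
- rewrite -(repK x) -(repK y) -(repK z) -clsD; try exact: rep_L2.
  rewrite !dotV_cls ?(dotPDl sH)//; try exact: rep_L2.
  by apply: (L2D sH); exact: rep_L2.
- rewrite -(repK x) -(repK y) -clsZ; last exact: rep_L2.
  rewrite !dotV_cls ?(dotPZl sH)//; try exact: rep_L2.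
  by apply: L2Z; exact: rep_L2.
- exact: dotP_ge0.
- rewrite -(repK x) -cls0; apply: cls_ae; first exact: rep_L2.
    exact: L2_cst.
  exact: (dotP_eq0 sH (rep_L2 x)).
Qed.

Lemma cls_inj_ae f g : H f -> H g -> cls f = cls g -> f = g %[ae P].
Proof.
move=> Hf Hg fg; have Hfg : H (f \- g) by exact: (L2B sH).
have : dotP P (f \- g) (f \- g) = 0.
  by rewrite -dotV_cls// clsB// fg subrr (dot0l dotV_inner).
move=> /(dotP_eq0 sH Hfg); apply: filterS => w /=.
by move=> /(_ I)/eqP; rewrite subr_eq0 => /eqP.
Qed.

Lemma dist_cls f g : H f -> H g ->
  dotV (cls f - cls g) (cls f - cls g) = dotP P (f \- g) (f \- g).
Proof. by move=> Hf Hg; rewrite -clsB// dotV_cls//; exact: (L2B sH). Qed.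

(** Only some representative has to be measurable for F_A; the chosen [rep] is only known to be
    measurable for the whole sequence. *)
Definition sub_space A : set L2space := cls @` L2F A.

Lemma sub_space_complete A (u : nat -> L2space) : (forall n, sub_space A (u n)) ->
  (forall e : R, 0 < e -> exists n, forall m, (n <= m)%N ->
     dotV (u m - u n) (u m - u n) < e) ->
  exists2 x, sub_space A x & hlim dotV \oo u x.
Proof.
move=> Au uC.
have /choice[v Av] n : exists f, L2F A f /\ cls f = u n.
  by case: (Au n) => f; exists f.
have Lv n : L2F A (v n) by case: (Av n).
have uE : u = cls \o v by apply/funext => n /=; case: (Av n).
have Hv n : H (v n) by exact: L2FT (Lv n).
have [e e0|f Lf vf] := @L2_complete _ _ _ P _ (@rv_sets_measurable A) v Lv.
  have [n un] := uC e e0; exists n => m nm.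
  by rewrite -dist_cls//; have := un m nm; rewrite uE.
exists (cls f); first by exists f.
move=> e e0; apply: filterS (vf _ e0) => n.
by rewrite uE/= dist_cls//; exact: L2FT Lf.
Qed.

Lemma sub_space_lin A a x y : sub_space A x -> sub_space A y ->
  sub_space A (a *: x + y).
Proof.
move=> [f Lf <-] [g Lg <-]; exists ((fun w => a * f w) \+ g).
  by apply: (L2D (@rv_sets_measurable A)) => //; exact: L2Z.
have Hf := L2FT Lf; have Hg := L2FT Lg.
by rewrite clsD ?clsZ//; exact: L2Z.
Qed.

Lemma sub_spaceT x : sub_space setT x.
Proof. by exists (rep x); [exact: rep_L2|exact: repK]. Qed.

End L2_space.

(** * Cylinders and the product formula *)

Section cylinders.
Context d (T : measurableType d) (R : realType) (P : probability T R)
  (dE : nat -> measure_display) (E : forall n, measurableType (dE n))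
  (X : forall n, {RV P >-> E n}).
Implicit Types (A : set nat) (B C : forall n, set (E n)) (n j : nat).

Definition cylinder B : set T := \bigcap_j (X j @^-1` B j).

(** Finitely many constrained coordinates, all in A. A total family equal to the whole space
    elsewhere makes intersections coordinatewise. *)
Definition cyl_base A B := [/\ forall j, measurable (B j),
  forall j, ~ A j -> B j = setT &
  exists n, forall j, (n <= j)%N -> B j = setT].

Definition cylinders A : set (set T) := cylinder @` cyl_base A.

Lemma cylinderI B C :
  cylinder B `&` cylinder C = cylinder (fun j => B j `&` C j).
Proof. by rewrite /cylinder -bigcapI. Qed.

Lemma cylinders_setI A : setI_closed (cylinders A).
Proof.
move=> _ _ [B [mB BA [n nB]] <-] [C [mC CA [m mC']] <-].
exists (fun j => B j `&` C j); last by rewrite cylinderI.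
split=> [j|j Aj|]; first exact: measurableI.
  by rewrite BA// CA// setIT.
exists (maxn n m) => j; rewrite geq_max => /andP[nj mj].
by rewrite nB// mC'// setIT.
Qed.

Lemma cylinders_setT A : cylinders A [set: T].
Proof.
exists (fun=> setT); first by split => //; exists 0%N.
by apply/seteqP; split.
Qed.

(** A cylinder is a countable intersection of events on coordinates in A, and a generating event is
    a cylinder with one constrained coordinate. *)
Lemma cylinders_sigma A : <<s cylinders A >> = <<s rv_sets X A >>.
Proof.
apply/seteqP; split; apply: smallest_sub; try exact: smallest_sigma_algebra.
  move=> _ [B [mB BA _] <-].
  apply: (@bigcap_measurableType _ (g_sigma_algebraType (rv_sets X A))) => j _.
  have [Aj|nAj] := pselect (A j).
    apply: sub_gen_smallest; exists j => //; exists (B j) => //.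
    by rewrite setTI.
  by rewrite BA// preimage_setT; exact: (@measurableT _ (g_sigma_algebraType (rv_sets X A))).
move=> _ [j Aj [C mC <-]]; apply: sub_gen_smallest.
pose B := dfwith (fun n => [set: E n]) j C.
have Bj : B j = C by rewrite /B dfwithin.
have Bi i : i <> j -> B i = setT by move=> /eqP ij; rewrite /B dfwithout// eq_sym.
exists B.
  split=> [i|i Ai|].
  - by have [->|/eqP ij] := eqVneq i j; [rewrite Bj|rewrite Bi].
  - by rewrite Bi// => ij; rewrite ij in Ai.
  - by exists j.+1 => i ji; rewrite Bi// => ij; rewrite ij ltnn in ji.
rewrite setTI; apply/seteqP; split=> [w /(_ j I)|w Cw i _ /=].
  by rewrite /= Bj.
by have [->|/eqP ij] := eqVneq i j; [rewrite Bj|rewrite Bi].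
Qed.

Lemma cylinders_measurable A : <<s cylinders A >> `<=` measurable.
Proof. by rewrite cylinders_sigma; exact: rv_sets_measurable. Qed.

Lemma L2F_cylinders A : L2 P (cylinders A) = L2F X A.
Proof.
apply/seteqP; split=> f [mf If]; split=> // _ C mC.
  by have := mf measurableT C mC; rewrite /measurable/= cylinders_sigma.
by have := mf measurableT C mC; rewrite /measurable/= -cylinders_sigma.
Qed.

Lemma L2F_cylinder A B : cyl_base A B -> L2F X A \1_(cylinder B).
Proof.
move=> BA; rewrite -L2F_cylinders; apply: (L2_indic P (@cylinders_measurable A)).
by apply: sub_gen_smallest; exists B.
Qed.

Lemma cyl_base_measurable A B : cyl_base A B -> measurable (cylinder B).
Proof.
move=> BA; apply: (@cylinders_measurable A); apply: sub_gen_smallest.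
by exists B.
Qed.

Definition rv_prob j (C : set (E j)) : R := fine (P (X j @^-1` C)).

Lemma rv_probT j : rv_prob (@setT (E j)) = 1.
Proof. by rewrite /rv_prob preimage_setT probability_setT. Qed.

Definition restr A B : forall j, set (E j) :=
  fun j => if `[< A j >] then B j else setT.

Lemma restr_cyl_base A B : cyl_base setT B -> cyl_base A (restr A B).
Proof.
move=> [mB _ [n nB]]; split=> [j|j Aj|]; rewrite /restr; first by case: ifP.
  by case: asboolP.
by exists n => j nj; rewrite nB// if_same.
Qed.

Arguments restr A B j : clear implicits.

Lemma cyl_baseT A B : cyl_base A B -> cyl_base setT B.
Proof. by case=> mB _ nB; split=> // j /(_ Logic.I). Qed.

(** The product of the probabilities of the coordinates outside A: the conditional expectation of a
    cylinder given F_A is this constant times the indicator of the cylinder restricted to A. *)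
Definition restr_coef A B n : R :=
  \prod_(j < n) (if `[< A j >] then 1 else rv_prob (B j)).

Context (indep : mutually_independent X).

(** Coordinates from n on are unconstrained, so independence of the variables of index below n is
    enough for the product formula. *)
Lemma cylinder_prob A B n : cyl_base A B -> (forall j, (n <= j)%N -> B j = setT) ->
  fine (P (cylinder B)) = \prod_(j < n) rv_prob (B j).
Proof.
move=> [mB _ _] nB; have := indep (box n) mB.
have -> : \bigcap_(j in [set` box n]) (X j @^-1` B j) = cylinder B.
  apply/seteqP; split=> w Bw j; last by move=> _; exact: Bw.
  move=> _; case: (ltnP j n) => nj; last by rewrite nB.
  by apply: Bw; rewrite /= in_box.
move=> ->; have -> : (\prod_(j <- box n) P (X j @^-1` B j) =
    (\prod_(j <- box n) rv_prob (B j))%:E)%E.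
  rewrite -prodEFin; apply: eq_bigr => j _; rewrite /rv_prob fineK//.
  by apply: fin_num_measure; exact: (measurable_funPTI (X j) (mB j)).
transitivity (\prod_(0 <= j < n) rv_prob (B j)); last by rewrite big_mkord.
apply: perm_big; apply: uniq_perm; first exact: fset_uniq.
  exact: iota_uniq.
by move=> j; rewrite in_box mem_index_iota.
Qed.

Lemma dotP_cylinder A B A' B' : cyl_base A B -> cyl_base A' B' ->
  dotP P \1_(cylinder B) \1_(cylinder B') =
  fine (P (cylinder (fun j => B j `&` B' j))).
Proof.
move=> bB bB'; rewrite /dotP /Rintegral; congr fine.
under eq_integral do rewrite -[_ * _]/((\1_(cylinder B) \* \1_(cylinder B')) _) -indicI.
rewrite cylinderI integral_indic ?setIT// -cylinderI.
by apply: measurableI; [exact: cyl_base_measurable bB|exact: cyl_base_measurable bB'].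
Qed.

(** Both sides are products over a common range. At j in A the factors coincide; at j outside A the
    set [C j] is the whole space, and the probability of [B j] missing on the right is supplied by
    the coefficient. *)
Lemma dotP_restr A B n C : cyl_base setT B -> (forall j, (n <= j)%N -> B j = setT) ->
  cyl_base A C ->
  dotP P \1_(cylinder B) \1_(cylinder C) =
  restr_coef A B n * dotP P \1_(cylinder (restr A B)) \1_(cylinder C).
Proof.
move=> bB nB bC; have [_ CA [m mC]] := bC; have [mB _ _] := bB; have [mC' _ _] := bC.
have bR := restr_cyl_base A bB; have [mR RA _] := bR.
rewrite !(dotP_cylinder (A := setT) (A' := A))//; last exact: cyl_baseT bR.
have bI D : (forall j, measurable (D j)) -> (forall j, (n <= j)%N -> D j = setT) ->
    cyl_base setT (fun j => D j `&` C j) /\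
    (forall j, (maxn n m <= j)%N -> D j `&` C j = setT).
  move=> mD nD; have h j : (maxn n m <= j)%N -> D j `&` C j = setT.
    by rewrite geq_max => /andP[nj mj]; rewrite nD// mC// setIT.
  split => //; split => [j|j /(_ Logic.I)//|]; first exact: measurableI.
  by exists (maxn n m).
have [bBC nBC] := bI _ mB nB.
have [|bRC nRC] := bI _ mR; first by move=> j nj; rewrite /restr nB// if_same.
rewrite (cylinder_prob bBC nBC) (cylinder_prob bRC nRC).
have -> : restr_coef A B n = restr_coef A B (maxn n m).
  have mk k : restr_coef A B k =
      \prod_(0 <= j < k) (if `[< A j >] then 1 else rv_prob (B j)).
    by rewrite /restr_coef big_mkord.
  rewrite !mk.
  rewrite (@big_cat_nat _ _ _ n 0%N (maxn n m)) ?leq_maxl//= [X in _ = _ * X]big1_seq ?mulr1//.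
  move=> j /andP[_]; rewrite mem_index_iota => /andP[nj _].
  by rewrite nB// rv_probT if_same.
rewrite /restr_coef -big_split/=; apply: eq_bigr => j _; rewrite /restr.
case: asboolP => Aj; first by rewrite mul1r.
by rewrite CA// !setIT rv_probT mulr1.
Qed.

End cylinders.

Arguments restr {dE E} A B j.
Lemma lt_quarters (R : realType) (p q e : R) :
  p < e / 4 -> q < e / 4 -> 2 * (p + q) < e.
Proof. lra. Qed.

(** * Conditional expectations as projections of classes *)

Section conditional_expectations.
Context d (T : measurableType d) (R : realType) (P : probability T R)
  (dE : nat -> measure_display) (E : forall n, measurableType (dE n))
  (X : forall n, {RV P >-> E n}) (indep : mutually_independent X).
Local Notation V := (L2space X).
Local Notation dot := (@dotV _ _ _ _ _ _ X).
Local Notation cls := (cls X).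
Local Notation sub_space := (@sub_space _ _ _ _ _ _ X).
Implicit Types (x y z h : V) (A : set nat) (B : forall n, set (E n)).
Let ip : inner_product dot := dotV_inner X.

Lemma approx_hlim (S : set V) x :
  (forall e : R, 0 < e -> exists2 y, S y & dot (x - y) (x - y) < e) ->
  exists2 u : nat -> V, forall n, S (u n) & hlim dot \oo u x.
Proof.
move=> xS; have /choice[u uS] (n : nat) :
    exists y, S y /\ dot (x - y) (x - y) < n.+1%:R^-1.
  by have [|y Sy yx] := xS n.+1%:R^-1; [rewrite invr_gt0|exists y].
exists u => [n|e e0]; first by case: (uS n).
have [n] := ltr_add_invr e0; rewrite add0r => ne; exists n => // m /= nm.
rewrite -(opprB x) (dotNl ip) (dotNr ip) opprK.
apply: lt_le_trans (proj2 (uS m)) _; apply: le_trans (ltW ne).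
by rewrite lef_pV2 ?posrE// ler_nat.
Qed.

Lemma sub_space_ind A (S : set V) :
  (forall B, cyl_base A B -> S (cls \1_(cylinder X B))) ->
  (forall a x y, S x -> S y -> S (a *: x + y)) ->
  (forall (u : nat -> V) x, (forall n, S (u n)) -> hlim dot \oo u x -> S x) ->
  forall x, sub_space A x -> S x.
Proof.
move=> Scyl Slin Scl x [f Lf <-].
have HL g : L2 P (cylinders X A) g -> L2F X setT g.
  by rewrite L2F_cylinders => /L2FT.
apply: (@L2_ind _ _ _ P _ (@cylinders_measurable _ _ _ _ _ _ X A)
  (@cylinders_setI _ _ _ _ _ _ X A) (@cylinders_setT _ _ _ _ _ _ X A) (fun f => S (cls f))).
- by move=> _ [B bB <-]; exact: Scyl.
- move=> a g g' /HL Lg /HL Lg' Sg Sg'.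
  have -> : cls (fun w => a * g w + g' w) = a *: cls g + cls g'.
    by rewrite -clsZ// -clsD//; exact: L2Z.
  exact: Slin.
- move=> g /HL Lg gS; have [|u Su ug] := @approx_hlim S (cls g).
    move=> e e0; have [g' [/HL Lg' Sg' gg']] := gS e e0.
    by exists (cls g') => //; rewrite dist_cls.
  exact: Scl ug.
- by rewrite L2F_cylinders.
Qed.

(** A relation, because values are exhibited on cylinders first and existence in general is derived
    from them. *)
Definition is_proj A x y := sub_space A y /\
  forall h, sub_space A h -> dot x h = dot y h.

Lemma is_proj_lin A a x x' y y' : is_proj A x y -> is_proj A x' y' ->
  is_proj A (a *: x + x') (a *: y + y').
Proof.
move=> [Ay xy] [Ay' xy']; split=> [|h Ah]; first exact: sub_space_lin.
by rewrite !(dotDl ip) !(dotZl ip) xy// xy'.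
Qed.

Lemma is_projB A x x' y y' : is_proj A x y -> is_proj A x' y' ->
  is_proj A (x - x') (y - y').
Proof.
move=> xy xy'; rewrite [x - x']addrC [y - y']addrC -(scaleN1r x') -(scaleN1r y').
exact: is_proj_lin.
Qed.

Lemma is_proj_le A x y : is_proj A x y -> dot y y <= dot x x.
Proof.
move=> [Ay xy]; have := dot_ge0 ip (x - y).
by rewrite (sqrB ip) (xy y Ay); have := dot_ge0 ip x; lra.
Qed.

Lemma is_proj_unique A x y y' : is_proj A x y -> is_proj A x y' -> y = y'.
Proof.
move=> xy xy'; have := is_proj_le (is_projB xy xy'); rewrite subrr (dot0l ip) => h.
apply/eqP; rewrite -subr_eq0; apply/eqP/(dot_eq0 ip)/eqP.
by rewrite eq_le h (dot_ge0 ip).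
Qed.

Lemma is_proj_id A x : sub_space A x -> is_proj A x x.
Proof. by []. Qed.

(** The test vector is itself treated by induction, which leaves only a pair of cylinders. *)
Lemma is_proj_cylinder A B n : cyl_base setT B ->
  (forall j, (n <= j)%N -> B j = setT) ->
  is_proj A (cls \1_(cylinder X B))
    (restr_coef X A B n *: cls \1_(cylinder X (restr A B))).
Proof.
move=> bB nB; have bR := restr_cyl_base A bB.
have LR := L2F_cylinder X bR; have HR := L2FT LR; have HB := L2F_cylinder X bB.
rewrite -(clsZ _ HR); split.
  by exists (fun w => restr_coef X A B n * \1_(cylinder X (restr A B)) w) => //;
    exact: L2Z.
apply: sub_space_ind => [C bC|a x y|u x] /=.
- have HC := L2FT (L2F_cylinder X bC).
  rewrite !dotV_cls//; last exact: L2Z.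
  by rewrite (dotPZl (@rv_sets_measurable _ _ _ _ _ _ X setT))//; exact: dotP_restr.
- by rewrite !(dotDr ip) !(dotZr ip) => -> ->.
- move=> uS ux; rewrite [LHS](dotC ip) [RHS](dotC ip).
  by apply: (hlim_dot_eq ip _ ux ux) => j; rewrite [LHS](dotC ip) uS (dotC ip).
Qed.

(** In the limit step contractivity makes the projections of a convergent sequence Cauchy; their
    limit stays in [sub_space A] by completeness, and the defining identities pass to the limit. *)
Lemma is_proj_ex A x : exists y, is_proj A x y.
Proof.
move: x (sub_spaceT x); apply: sub_space_ind => [B bB|a x y|u x] /=.
- by case: (bB) => _ _ [n nB]; eexists; exact: is_proj_cylinder nB.
- by move=> [x' xx'] [y' yy']; eexists; exact: is_proj_lin xx' yy'.
- move=> /choice[v uv] ux.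
  have [||y Ay vy] := @sub_space_complete _ _ _ P _ _ X A v.
  + by move=> n; case: (uv n).
  + move=> e e0; have e4 : 0 < e / 4 by rewrite divr_gt0.
    have [n _ hn] := ux _ e4; exists n => m nm.
    apply: le_lt_trans (is_proj_le (is_projB (uv m) (uv n))) _.
    apply: le_lt_trans (sqrB_le ip x _ _) _.
    exact: lt_quarters (hn m nm) (hn n (leqnn n)).
  exists y; split=> // h Ah.
  by apply: (hlim_dot_eq ip _ ux vy) => j; exact: (proj2 (uv j)).
Qed.

Definition cexp A x : V := xget 0 [set y | is_proj A x y].

Lemma cexpP A x : is_proj A x (cexp A x).
Proof. exact: (@xgetPex _ 0 [set y | is_proj A x y] (is_proj_ex A x)). Qed.

Lemma cexp_eq A x y : is_proj A x y -> cexp A x = y.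
Proof. exact: is_proj_unique (cexpP A x). Qed.

Lemma cexp_lin A a x y : cexp A (a *: x + y) = a *: cexp A x + cexp A y.
Proof. by apply: cexp_eq; apply: is_proj_lin; exact: cexpP. Qed.

Lemma cexpB A x y : cexp A (x - y) = cexp A x - cexp A y.
Proof. by apply: cexp_eq; apply: is_projB; exact: cexpP. Qed.

Lemma cexp_hlim A (u : nat -> V) x : hlim dot \oo u x ->
  hlim dot \oo (fun n => cexp A (u n)) (cexp A x).
Proof.
move=> ux; apply: hlim_le ux => n; rewrite -cexpB; exact: is_proj_le (cexpP _ _).
Qed.

(** On a cylinder, restricting to A' and then to A is restricting to the intersection, and the
    coefficients multiply; linearity and contractivity extend the identity. *)
Lemma cexpI A A' x : cexp A (cexp A' x) = cexp (A `&` A') x.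
Proof.
move: x (sub_spaceT x); apply: sub_space_ind => [B bB|a x y|u x] /=.
- case: (bB) => _ _ [n nB].
  rewrite (cexp_eq (is_proj_cylinder A' bB nB)).
  have bR := cyl_baseT (restr_cyl_base A' bB).
  have nR j : (n <= j)%N -> restr A' B j = setT.
    by move=> nj; rewrite /restr nB// if_same.
  (* The added 0 gives the scalar multiple the shape expected by [cexp_lin]. *)
  rewrite -[in LHS](addr0 (_ *: _)) cexp_lin.
  rewrite (cexp_eq (is_proj_cylinder A bR nR)).
  have cexp0 : cexp A 0 = 0 by have := cexpB A 0 0; rewrite !subrr.
  rewrite cexp0 addr0 (cexp_eq (is_proj_cylinder (A `&` A') bB nB)) scalerA.
  congr (_ *: cls \1_(cylinder X _)).
    rewrite /restr_coef -big_split/=; apply: eq_bigr => j _; rewrite /restr.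
    rewrite asbool_and; case: asboolP => Aj; case: asboolP => A'j;
    by rewrite /= ?rv_probT ?mulr1 ?mul1r.
  apply: functional_extensionality_dep => j; rewrite /restr asbool_and.
  by case: asboolP; case: asboolP.
- by rewrite !cexp_lin => -> ->.
- move=> uS ux; apply: (hlim_unique ip (cexp_hlim A (cexp_hlim A' ux))).
  by under eq_fun do rewrite uS; exact: cexp_hlim.
Qed.

Lemma cexp_sym A x y : dot (cexp A x) y = dot x (cexp A y).
Proof.
have [Ax xP] := cexpP A x; have [Ay yP] := cexpP A y.
by rewrite (xP _ Ay) [LHS](dotC ip) (yP _ Ax) (dotC ip).
Qed.

Lemma cexpT x : cexp setT x = x.
Proof. by apply: cexp_eq; apply: is_proj_id; exact: sub_spaceT. Qed.

(** A cylinder constrains finitely many coordinates, so its conditional expectations are eventually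
    the cylinder itself. *)
Lemma cexp_lim x : hlim dot \oo (fun n => cexp `I_n x) x.
Proof.
move: x (sub_spaceT x); apply: sub_space_ind => [B bB|a x y|u x] /=.
- case: (bB) => mB _ [n nB]; apply: (hlim_near _ (hlim_cst ip _)).
  exists n => // m /= nm; apply/esym/cexp_eq/is_proj_id.
  exists \1_(cylinder X B) => //; apply: L2F_cylinder; split=> // [j /= jm|].
    by apply: nB; rewrite leqNgt; apply/negP => jn; apply: jm; exact: leq_trans nm.
  by exists n.
- move=> hx hy; under eq_fun do rewrite cexp_lin.
  by apply: (hlimD ip) => //; exact: (hlimZ ip).
(* The squared triangle inequality is applied twice, one use inside the other, hence the two factors
   4. *)
- move=> uS ux e e0; have e8 : 0 < e / 4 / 4 by rewrite !divr_gt0.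
  have [n _ /(_ n (leqnn n)) /= un] := ux _ e8.
  apply: filterS (uS n _ e8) => m um.
  apply: le_lt_trans (sqrB_le ip (cexp `I_m (u n)) _ _) _.
  rewrite -cexpB; apply: lt_quarters.
    apply: le_lt_trans (is_proj_le (cexpP `I_m (x - u n))) _.
    rewrite -(opprB (u n)) (dotNl ip) (dotNr ip) opprK.
    by apply: lt_trans un _; rewrite gtr_pMr ?divr_gt0// invf_lt1 ?ltr1n.
  apply: le_lt_trans (sqrB_le ip (u n) _ _) _; apply: lt_quarters.
    by rewrite -(opprB (u n)) (dotNl ip) (dotNr ip) opprK.
  exact: um.
Qed.

Lemma cexp_space : hoeffding_space dot cexp.
Proof.
split=> //.
- move=> u uC; have [|x _ ux] := @sub_space_complete _ _ _ P _ _ X setT u _ uC.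
    by move=> n; exact: sub_spaceT.
  by exists x.
- exact: cexpI.
- exact: cexp_sym.
- exact: cexpT.
- exact: cexp_lim.
Qed.

End conditional_expectations.

(** * The operators on representatives *)

#[local] Existing Instance summability.totally_filter.

Section representatives.
Context d (T : measurableType d) (R : realType) (P : probability T R)
  (dE : nat -> measure_display) (E : forall n, measurableType (dE n))
  (X : forall n, {RV P >-> E n}) (indep : mutually_independent X).
Local Notation V := (L2space X).
Local Notation dot := (@dotV _ _ _ _ _ _ X).
Local Notation cls := (cls X).
Local Notation H := (L2F X setT).
Local Notation cexp := (@cexp _ _ _ _ _ _ X).
Local Notation comp := (comp cexp).
Local Notation dmal := (dmal cexp).
Let ip : inner_product dot := dotV_inner X.
Let hs : hoeffding_space dot cexp := cexp_space indep.
Let sH := @rv_sets_measurable _ _ _ _ _ _ X setT.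
Implicit Types (f g F G : TX X -> R) (A : set nat).

Lemma integral_PX (h : TX X -> \bar R) : measurable_fun [set: TX X] h ->
  (forall w, 0 <= h w)%E -> (\int[PX X]_w h w = \int[P]_(w in [set: T]) h w)%E.
Proof. by move=> mh h0; rewrite ge0_integral_distribution. Qed.

Lemma sqr_Lnorm d' (U : measurableType d') (mu : {measure set U -> \bar R})
    (f : U -> R) :
  ('N[mu]_2%:E[EFin \o f] = (\int[mu]_w ((f w) ^+ 2)%:E) `^ 2^-1)%E.
Proof.
rewrite unlock; congr poweR; apply: eq_integral => w _.
by rewrite /= powR_mulrn// real_normK ?num_real.
Qed.

Lemma measurable_sqrE d' (U : measurableType d') (f : U -> R) :
  measurable_fun setT f -> measurable_fun setT (fun w => (f w ^+ 2)%:E).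
Proof. by move=> mf; apply/measurable_EFinP; exact: measurable_funX. Qed.

Lemma L2_lty f : measurable_fun [set: TX X] f ->
  H f <-> (\int[P]_(w in [set: T]) (f w ^+ 2)%:E < +oo)%E.
Proof.
move=> mf; have mT := @measurable_sqrE _ T _ (sub_measurable_fun sH mf).
split=> [[_ /integrableP[_]]|fy].
  by under eq_integral do rewrite /= ger0_norm ?sqr_ge0//.
split=> //; apply/integrableP; split=> //.
by under eq_integral do rewrite /= ger0_norm ?sqr_ge0//.
Qed.

Lemma L2XE f : L2X f <-> H f.
Proof.
rewrite /L2X/= inE; split=> [/andP[/[!inE]/= mf]|Hf].
  rewrite /finite_norm sqr_Lnorm => fy; apply/(L2_lty mf).
  rewrite -integral_PX; [|exact: measurable_sqrE|by move=> w; rewrite lee_fin sqr_ge0].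
  by apply: (@lty_poweRy _ _ 2^-1).
have mf : measurable_fun [set: TX X] f by case: Hf.
apply/andP; split; rewrite inE//= /finite_norm sqr_Lnorm.
rewrite integral_PX; [|exact: measurable_sqrE|by move=> w; rewrite lee_fin sqr_ge0].
by apply: poweR_lty; exact/(L2_lty mf).
Qed.

Lemma norm2E f : H f -> norm2 f = (Num.sqrt (dotP P f f))%:E.
Proof.
move=> Hf; have mf : measurable_fun [set: TX X] f by case: Hf.
rewrite /norm2 sqr_Lnorm.
rewrite integral_PX; [|exact: measurable_sqrE|by move=> w; rewrite lee_fin sqr_ge0].
under eq_integral do rewrite expr2.
by rewrite -(dotPE sH Hf Hf) poweR_EFin powR12_sqrt// dotP_ge0.
Qed.

Lemma expectation_sqr f : H f -> ('E_P[fun w : T => (f w ^+ 2)%R] = (dot (cls f) (cls f))%:E)%E.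
Proof.
move=> Hf; rewrite unlock dotV_cls// (dotPE sH Hf Hf).
by apply: eq_integral => w _; rewrite expr2.
Qed.

Lemma expectation_mul f g : H f -> H g ->
  ('E_P[fun w : T => (f w * g w)%R] = (dot (cls f) (cls g))%:E)%E.
Proof. by move=> Hf Hg; rewrite unlock dotV_cls// (dotPE sH Hf Hg). Qed.

Lemma norm2_cvg (J : Type) (Phi : set_system J) {FF : ProperFilter Phi}
    (u : J -> TX X -> R) G : (forall j, H (u j)) -> H G ->
  ((fun j => norm2 (fun w => u j w - G w)) @ Phi --> 0%E) <->
  hlim dot Phi (fun j => cls (u j)) (cls G).
Proof.
move=> Hu HG.
have HuG j : H (fun w => u j w - G w) := L2B sH (Hu j) HG.
have uE j : norm2 (fun w => u j w - G w) =
    (Num.sqrt (dot (cls (u j) - cls G) (cls (u j) - cls G)))%:E.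
  by rewrite norm2E// dist_cls.
split=> [/fine_cvgP[_ /cvgrPdist_lt uG] e e0|uG].
  have se : 0 < Num.sqrt e by rewrite sqrtr_gt0.
  apply: filterS (uG _ se) => j; rewrite /= uE /= sub0r normrN ger0_norm ?sqrtr_ge0//.
  by rewrite ltr_sqrt.
apply/fine_cvgP; split; first by apply: nearW => j; rewrite uE.
apply/cvgrPdist_lt => e e0; have e2 : 0 < e ^+ 2 by rewrite exprn_gt0.
apply: filterS (uG _ e2) => j uj; rewrite /= uE/= sub0r normrN.
rewrite ger0_norm ?sqrtr_ge0// -(ger0_norm (ltW e0)) -sqrtr_sqr.
by rewrite ltr_sqrt.
Qed.

Lemma L2_limE (J : Type) (Phi : set_system J) {FF : ProperFilter Phi}
    (u : J -> TX X -> R) G : (forall j, H (u j)) ->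
  L2_lim Phi u G <-> H G /\ hlim dot Phi (fun j => cls (u j)) (cls G).
Proof.
move=> Hu; split=> [[/L2XE HG /norm2_cvg uG]|[HG uG]].
  by split => //; exact: uG.
by split; [exact/L2XE|exact/norm2_cvg].
Qed.

Lemma integral_indicM f (B : set T) : H f -> <<s rv_sets X setT >> B ->
  (\int[P]_(w in B) (f w)%:E = (dotP P f \1_B)%:E)%E.
Proof.
move=> Hf mB; rewrite (dotPE sH Hf (L2_indic P sH mB)) integral_mkcond.
apply: eq_integral => w _; rewrite patchE indicE.
by case: (w \in B); rewrite ?mulr1 ?mulr0.
Qed.

(** The difference of two versions integrates to 0 over the set where it is nonnegative and over the
    complement, so its absolute value has integral 0. A version is only assumed integrable; square
    integrability is inherited from g. *)
Lemma is_cond_exp_unique A f (g g' : T -> R) : L2F X A g ->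
  is_cond_exp P (rv_sets X A) f g -> is_cond_exp P (rv_sets X A) f g' ->
  L2F X A g' /\ g' = g %[ae P].
Proof.
move=> Lg [mg ig gf] [mg' ig' gf'].
have sA := @rv_sets_measurable _ _ _ _ _ _ X A.
have mgT := sub_measurable_fun sA mg; have mgT' := sub_measurable_fun sA mg'.
pose D w := g' w - g w.
have mD : measurable_fun [set: g_sigma_algebraType (rv_sets X A)] D.
  exact: measurable_funB.
have mDT := sub_measurable_fun sA mD.
have iD : P.-integrable setT (EFin \o D).
  by have := integrableB measurableT ig' ig; congr (P.-integrable _ _).
have D0 B : <<s rv_sets X A >> B -> (\int[P]_(w in B) (D w)%:E = 0)%E.
  move=> mB; have mB' := sA _ mB.
  under eq_integral do rewrite EFinB.
  rewrite integralB//; [|exact: integrableS ig'|exact: integrableS ig].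
  have := gf _ mB; have := gf' _ mB => /= -> ->.
  rewrite subee//; have := gf _ mB => /= <-.
  by apply: integrable_fin_num => //; exact: integrableS ig.
have Dae : ae_eq P setT (EFin \o D) (cst 0%E).
  apply/ae_eq_integral_abs => //; first exact/measurable_EFinP.
  pose B := D @^-1` `[0, +oo[.
  have mB : <<s rv_sets X A >> B.
    by have := mD measurableT `[0, +oo[%classic (measurable_itv _); rewrite setTI.
  have mB' := sA _ mB.
  have mBC : <<s rv_sets X A >> (~` B).
    exact: (@measurableC _ (g_sigma_algebraType (rv_sets X A))).
  rewrite -(setUv B) ge0_integral_setU//=.
  - rewrite (_ : (\int[P]_(x in B) `|D x|%:E = 0)%E) ?add0e; last first.
      rewrite -[RHS](D0 _ mB); apply: eq_integral => w /[!inE].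
      by rewrite /B/= in_itv/= andbT => Dw; rewrite ger0_norm.
    transitivity (\int[P]_(x in ~` B) ((-1)%:E * (D x)%:E))%E.
      apply: eq_integral => w /[!inE]; rewrite /B/= in_itv/= andbT => /negP.
      by rewrite -ltNge => Dw; rewrite ltr0_norm// -EFinM mulN1r.
    by rewrite integralZl ?D0 ?mule0//; [exact: sA|apply: integrableS iD => //; exact: sA].
  - exact: measurableC.
  - rewrite setUv; apply/measurable_EFinP; exact: measurableT_comp.
  - by apply/disj_setPS => w [].
have gg' : g' = g %[ae P].
  by apply: filterS Dae => w /(_ I) [] /eqP; rewrite subr_eq0 => /eqP.
split => //; split => //; case: Lg => _ /integrableP[_ ify].
apply/integrableP; split; first exact: measurable_sqrE.
apply: le_lt_trans ify; rewrite le_eqVlt; apply/orP; left; apply/eqP.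
apply: ge0_ae_eq_integral => //.
- by apply: measurableT_comp => //; exact: measurable_sqrE.
- by apply: measurableT_comp => //; exact: measurable_sqrE.
- by apply: filterS gg' => w /(_ I) /= -> _.
Qed.

(** An F_A-measurable representative of the projection is a version, by testing on indicators. So
    the choice in [cond_exp] is not vacuous, and uniqueness identifies its value. *)
Lemma cond_expP A f : H f ->
  L2F X A (cond_exp P (rv_sets X A) f) /\
  cls (cond_exp P (rv_sets X A) f) = cexp A (cls f).
Proof.
move=> Hf; have [[g Lg gE] gP] := cexpP indep A (cls f).
have Hg := L2FT Lg; have sA := @rv_sets_measurable _ _ _ _ _ _ X A.
have gf : is_cond_exp P (rv_sets X A) f g.
  split; first by case: Lg.
    exact: (L2_integrable sH).
  move=> B mB; have LB : L2F X A \1_B := L2_indic P sA mB.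
  have mBT : <<s rv_sets X setT >> B by apply: rv_sets_sub mB.
  rewrite !integral_indicM//; congr EFin.
  have HB := L2FT LB.
  by rewrite -(dotV_cls Hg HB) -(dotV_cls Hf HB) gE; apply/esym/gP; exists \1_B.
have gf' : is_cond_exp P (rv_sets X A) f (cond_exp P (rv_sets X A) f).
  exact: (@getPex _ [set g | is_cond_exp P (rv_sets X A) f g] (ex_intro _ g gf)).
have [Lg' gg'] := is_cond_exp_unique Lg gf gf'.
by split => //; rewrite -gE; apply: cls_ae => //; exact: L2FT Lg'.
Qed.

Lemma hoeffding_cls f (M : {fset nat}) : H f ->
  L2F X [set` M] (hoeffding f M) /\ cls (hoeffding f M) = comp M (cls f).
Proof.
move=> Hf.
have Lc (K : {fset nat}) : H (cond_exp P (rv_sets X [set` K]) f).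
  by case: (cond_expP [set` K] Hf) => /L2FT.
split.
  have -> : hoeffding f M = (fun w => \sum_(K <- fpowerset M | K \in fpowerset M)
      (-1) ^+ (#|` M| - #|` K|) * cond_exp P (rv_sets X [set` K]) f w).
    by apply/funext => w; rewrite /hoeffding big_seq.
  apply: (L2_sum_closed (@rv_sets_measurable _ _ _ _ _ _ X _)) => K.
  rewrite fpowersetE => KM; apply: L2Z.
  have [LK _] := cond_expP [set` K] Hf; apply: L2F_sub LK.
  by move=> i /=; exact: (fsubsetP KM).
rewrite /hoeffding cls_sum; last by move=> K _; exact: (L2Z _ (Lc K)).
apply: eq_bigr => K _; rewrite (clsZ _ (Lc K)).
by have [_ ->] := cond_expP [set` K] Hf.
Qed.

Lemma hoeffding_L2 f (M : {fset nat}) : H f -> H (hoeffding f M).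
Proof. by move=> /(hoeffding_cls M)[/L2FT]. Qed.

Lemma malliavin_cls k f : H f ->
  H (malliavin_D k f) /\ cls (malliavin_D k f) = dmal k (cls f).
Proof.
move=> Hf; have [/L2FT Lk cE] := cond_expP [set j | j <> k] Hf.
split; first exact: (L2B sH).
by rewrite [LHS](clsB Hf Lk) cE.
Qed.

Lemma sum_malliavin_cls m f : H f ->
  H (fun w => \sum_(k < m) malliavin_D k f w) /\
  cls (fun w => \sum_(k < m) malliavin_D k f w) = mdiv cexp m (cls f).
Proof.
move=> Hf; have HD k : H (malliavin_D k f) by case: (malliavin_cls k Hf).
split; first by apply: (L2_sum_closed sH) => k _; exact: HD.
rewrite cls_sum; last by move=> k _; exact: HD.
 apply: eq_bigr => k _; by case: (malliavin_cls k Hf).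
Qed.

(** The partial sum over B has the components of y at the indices in B and 0 elsewhere: y dominates,
    and the component at M is final once B contains M. *)
Lemma sum_multiplier_lim (Q : pred {fset nat}) (c : {fset nat} -> R) x y :
  (forall M, comp M y = if Q M then c M *: comp M x else 0) ->
  hlim dot summability.totally
    (fun B : {fset {fset nat}} => \sum_(M <- B | Q M) c M *: comp M x) y.
Proof.
move=> yE.
have uE (B : {fset {fset nat}}) M : comp M (\sum_(K <- B | Q K) c K *: comp K x) =
    if M \in B then comp M y else 0.
  rewrite (comp_sum hs) yE; case: ifPn => MB; last first.
    rewrite big1_seq// => K /andP[_ KB]; rewrite (compZ hs) (comp_comp hs).
    by case: eqP => [MK|]; rewrite ?scaler0//; rewrite MK KB in MB.
  rewrite big_mkcond (big_fsetD1 M)//= big1_seq ?addr0.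
    case: ifP => // _; by rewrite (compZ hs) (comp_comp hs) eqxx.
  move=> K /andP[_]; rewrite !inE => /andP[KM _].
  case: ifP => // _; rewrite (compZ hs) (comp_comp hs) eq_sym (negbTE KM).
  exact: scaler0.
apply: (@hlim_comp0 _ _ _ _ hs _ _ _ _ _ y) => [B M|M].
  rewrite (compD hs) (compN hs) uE; case: ifP => _.
    by rewrite subrr (dot0l ip) (dot_ge0 ip).
  by rewrite sub0r (dotNl ip) (dotNr ip) opprK.
exists [fset M]%fset => // B /= MB; rewrite uE.
by rewrite (fsubsetP MB)// inE.
Qed.

Lemma order_ex p x : exists y, forall M, comp M y = if #|` M| == p then comp M x else 0.
Proof.
have [|y yE] := @multiplier_ex _ _ _ _ hs (fun M => (#|` M| == p)%:R) x (dot x x).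
  move=> n; apply: le_trans (proj_le hs `I_n x); rewrite (sqr_proj hs).
  apply: ler_sum => M _; case: eqP => _; rewrite ?expr1n ?mul1r//.
  by rewrite expr0n mul0r (dot_ge0 ip).
by exists y => M; rewrite yE; case: eqP => _; rewrite ?scale1r ?scale0r.
Qed.

Lemma L2_sumE (I : choiceType) (Q : pred I) (u : I -> TX X -> R) G :
  (forall i, H (u i)) -> L2_sum Q u G <-> H G /\
    hlim dot summability.totally
      (fun B : {fset I} => \sum_(i <- B | Q i) cls (u i)) (cls G).
Proof.
move=> Hu; rewrite /L2_sum.
have -> : (fun B : {fset I} => \sum_(i <- B | Q i) cls (u i)) =
    (fun B : {fset I} => cls (fun w => \sum_(i <- B | Q i) u i w)).
  by apply/funext => B; rewrite cls_sum.
by apply: L2_limE => B; apply: (L2_sum_closed sH) => i _; exact: Hu.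
Qed.

(** The multiplier equal to 1 on sets of size p and 0 elsewhere provides a sum of the series, so
    [get] selects one; uniqueness of limits then gives its components. *)
Lemma hoeffding_orderP f p : H f -> H (hoeffding_order f p) /\
  forall M, comp M (cls (hoeffding_order f p)) =
    if #|` M| == p then comp M (cls f) else 0.
Proof.
move=> Hf; have [y yE] := order_ex p (cls f).
have Hh M : H (hoeffding f M) by exact: hoeffding_L2.
have lim_y : hlim dot summability.totally (fun B : {fset {fset nat}} =>
    \sum_(M <- B | #|` M| == p) cls (hoeffding f M)) y.
  have := @sum_multiplier_lim (fun M => #|` M| == p) (fun=> 1) (cls f) y.
  have -> : (fun B : {fset {fset nat}} =>
      \sum_(M <- B | #|` M| == p) 1 *: comp M (cls f)) =
    (fun B : {fset {fset nat}} => \sum_(M <- B | #|` M| == p) cls (hoeffding f M)).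
    apply/funext => B; apply: eq_bigr => M _; rewrite scale1r.
    by case: (hoeffding_cls M Hf).
  by apply => M; rewrite yE scale1r.
have : L2_sum (fun M : {fset nat} => #|` M| == p) (hoeffding f)
    (hoeffding_order f p).
  apply: (@getPex _ [set G | L2_sum (fun M : {fset nat} => #|` M| == p) (hoeffding f) G]).
  exists (rep y); apply/(L2_sumE _ _ Hh).
  by split; [exact: rep_L2|rewrite repK].
move=> /(L2_sumE _ _ Hh)[HG Gy]; split => // M.
by rewrite (hlim_unique ip Gy lim_y) yE.
Qed.

End representatives.

(** * The gradient and the Ornstein-Uhlenbeck domain *)

HB.instance Definition _ (R : realType) :=
  @Measure_isSigmaFinite.Build _ nat R (@counting nat R) (sigma_finite_counting R).

(** * The product with counting measure, section by section *)

Section product.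
Context d (T : measurableType d) (R : realType) (P : probability T R)
  (dE : nat -> measure_display) (E : forall n, measurableType (dE n))
  (X : forall n, {RV P >-> E n}).
Local Notation V := (L2space X).
Local Notation dot := (@dotV _ _ _ _ _ _ X).
Local Notation cls := (cls X).
Local Notation H := (L2F X setT).
Let ip : inner_product dot := dotV_inner X.
Let sH := @rv_sets_measurable _ _ _ _ _ _ X setT.
Implicit Types (U W : nat * TX X -> R).

Lemma measurable_section U k : measurable_fun setT U ->
  measurable_fun [set: TX X] (fun w => U (k, w)).
Proof. by move=> mU; apply: (measurableT_comp mU); exact: pair1_measurable. Qed.

Lemma measurable_sections U :
  (forall k, measurable_fun [set: TX X] (fun w => U (k, w))) -> measurable_fun setT U.
Proof.
move=> mU _ Y mY; rewrite setTI.
have -> : U @^-1` Y = \bigcup_k ([set k] `*` ((fun w => U (k, w)) @^-1` Y)).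
  by apply/seteqP; split=> [[k w] /= UY|[k w] [j _ [/= ->]]]; [exists k|].
apply: bigcup_measurable => k _; apply: measurableX => //.
by rewrite -[X in measurable X]setTI; exact: mU.
Qed.

Lemma integral_prodPX (h : nat * TX X -> \bar R) : measurable_fun setT h ->
  (forall z, 0 <= h z)%E ->
  (\int[prodPX X]_z h z = \sum_(0 <= k <oo) \int[P]_(w in [set: T]) h (k, w))%E.
Proof.
move=> mh h0; transitivity (\int[@counting nat R]_k fubini_F (PX X) h k)%E.
  exact: (@fubini_tonelli1 _ _ nat (TX X) R (@counting nat R) (PX X) h mh h0).
rewrite ge0_integral_count => [|k]; last exact: integral_ge0.
apply: eq_eseriesr => k _; rewrite /fubini_F integral_PX//.
by apply: (measurableT_comp mh); exact: pair1_measurable.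
Qed.

Lemma norm2prodE U : measurable_fun setT U ->
  norm2prod U = ((\sum_(0 <= k <oo) \int[P]_(w in [set: T]) (U (k, w) ^+ 2)%:E) `^ 2^-1)%E.
Proof.
move=> mU; rewrite /norm2prod sqr_Lnorm integral_prodPX//.
  exact: measurable_sqrE.
by move=> z; rewrite lee_fin sqr_ge0.
Qed.

Lemma L2prodE U : L2prod U <-> measurable_fun setT U /\
  (\sum_(0 <= k <oo) \int[P]_(w in [set: T]) (U (k, w) ^+ 2)%:E < +oo)%E.
Proof.
rewrite /L2prod/= inE; split=> [/andP[/[!inE]/= mU]|[mU Uy]].
  rewrite /finite_norm -/(norm2prod U) norm2prodE// => Uy; split=> //.
  by apply: (@lty_poweRy _ _ 2^-1).
apply/andP; split; rewrite inE//= /finite_norm -/(norm2prod U) norm2prodE//.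
exact: poweR_lty.
Qed.

Lemma L2prod_section U k : L2prod U -> H (fun w => U (k, w)).
Proof.
move=> /L2prodE[mU Uy]; apply/(L2_lty (measurable_section k mU)).
have s0 j : (0 <= \int[P]_(w in [set: T]) (U (j, w) ^+ 2)%:E)%E.
  by apply: integral_ge0 => w _; rewrite lee_fin sqr_ge0.
apply: le_lt_trans Uy; rewrite (nneseriesD1 (n := k))// leeDl//.
exact: nneseries_ge0.
Qed.

Lemma integral_section U k : H (fun w => U (k, w)) ->
  (\int[P]_(w in [set: T]) (U (k, w) ^+ 2)%:E)%E =
  (dot (cls (fun w => U (k, w))) (cls (fun w => U (k, w))))%:E.
Proof. by move=> HU; rewrite -expectation_sqr// unlock. Qed.

Lemma norm2prod_sections U : (forall k, H (fun w => U (k, w))) ->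
  norm2prod U = ((\sum_(0 <= k <oo)
    (dot (cls (fun w => U (k, w))) (cls (fun w => U (k, w))))%:E) `^ 2^-1)%E.
Proof.
move=> HU; rewrite norm2prodE; last first.
  by apply: measurable_sections => k; case: (HU k).
by congr poweR; apply: eq_eseriesr => k _; exact: integral_section.
Qed.

Lemma L2prod_sections U : (forall k, H (fun w => U (k, w))) ->
  (\sum_(0 <= k <oo)
    (dot (cls (fun w => U (k, w))) (cls (fun w => U (k, w))))%:E < +oo)%E ->
  L2prod U.
Proof.
move=> HU Uy; apply/L2prodE; split.
  by apply: measurable_sections => k; case: (HU k).
by under eq_eseriesr do rewrite integral_section//.
Qed.

(** The product of two square integrable functions is integrable, so Fubini gives an absolutely
    convergent series over sections. The value is recorded as a limit of partial sums, the form that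
    [dot_mdiv] produces. *)
Lemma inner_prod_lim U W : L2prod U -> L2prod W ->
  exists2 r : R, inner_prod U W = r%:E &
  (\sum_(k < m) dot (cls (fun w => U (k : nat, w))) (cls (fun w => W (k : nat, w))))
    @[m --> \oo] --> r.
Proof.
move=> LU LW.
have HU k := L2prod_section k LU; have HW k := L2prod_section k LW.
have iUW : (prodPX X).-integrable setT (EFin \o (U \* W)).
  by apply/Lfun1_integrable; exact: Lfun2_mul_Lfun1.
have := @integral12_prod_meas1 _ _ nat (TX X) R (@counting nat R) (PX X) _ iUW.
have := @integrable_fubini_F _ _ nat (TX X) R (@counting nat R) (PX X) _ iUW.
have -> : fubini_F (PX X) (EFin \o (U \* W)) = (fun k =>
    (dot (cls (fun w => U (k, w))) (cls (fun w => W (k, w))))%:E).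
  apply/funext => k; rewrite /fubini_F dotV_cls// (dotPE sH (HU k) (HW k)).
  rewrite integral_distribution//.
  - by apply/measurable_EFinP; apply: measurable_funM; [case: (HU k)|case: (HW k)].
  - exact: (L2_mul_integrable sH (HU k) (HW k)).
pose a k := dot (cls (fun w => U (k, w))) (cls (fun w => W (k, w))).
rewrite -/a => /integrableP[_ ia] iE.
have sa : (\sum_(0 <= k <oo) `|a k|%:E < +oo)%E.
  by rewrite -ge0_integral_count// => k; rewrite lee_fin.
have /cvg_ex[r ar] : cvgn (series a).
  apply: normed_cvg.
  exact: (@nnseries_is_cvg _ (fun k => `|a k|) (fun k => normr_ge0 (a k)) sa).
exists r; last first.
  move: ar; rewrite (_ : series a = fun m => \sum_(k < m) a k)//.
  by apply/funext => m; rewrite /series/= big_mkord.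
have -> : inner_prod U W = (\int[@counting nat R]_k (a k)%:E)%E by exact: esym iE.
rewrite integral_count.
  apply/cvg_lim => //; rewrite (_ : (fun n => _) = EFin \o series a).
    by apply: cvg_EFin; [exact: nearW|exact: ar].
  by apply/funext => m; rewrite /series/= sumEFin.
by rewrite /summable; move: sa; rewrite nneseries_esumT.
Qed.

End product.

(** * The closed gradient, the divergence and the generator *)

Section gradient.
Context d (T : measurableType d) (R : realType) (P : probability T R)
  (dE : nat -> measure_display) (E : forall n, measurableType (dE n))
  (X : forall n, {RV P >-> E n}) (indep : mutually_independent X).
Local Notation V := (L2space X).
Local Notation dot := (@dotV _ _ _ _ _ _ X).
Local Notation cls := (cls X).
Local Notation H := (L2F X setT).
Local Notation cexp := (@cexp _ _ _ _ _ _ X).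
Local Notation comp := (comp cexp).
Local Notation dmal := (dmal cexp).
Local Notation mdiv := (mdiv cexp).
Local Notation number_op := (number_op cexp).
Let ip : inner_product dot := dotV_inner X.
Let hs : hoeffding_space dot cexp := cexp_space indep.
Let sH := @rv_sets_measurable _ _ _ _ _ _ X setT.
Implicit Types (F G : TX X -> R) (U W : nat * TX X -> R) (x y N : V).

(** Only the classes of the sections matter, so the energy identity applies to a gradient and
    equally to a difference of two gradients. *)
Lemma norm2prod_dmal U x N : (forall k, H (fun w => U (k, w))) ->
  (forall k, cls (fun w => U (k, w)) = dmal k x) -> number_op x N ->
  L2prod U /\ norm2prod U = (Num.sqrt (dot x N))%:E.
Proof.
move=> HU Ux xN.
have sE : (\sum_(0 <= k <oo) (dot (cls (fun w => U (k, w)))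
    (cls (fun w => U (k, w))))%:E = (dot x N)%:E)%E.
  by under eq_eseriesr do rewrite Ux; exact: dmal_series_nneseries.
split; first by apply: L2prod_sections => //; rewrite sE ltry.
rewrite norm2prod_sections// sE poweR_EFin powR12_sqrt//.
by rewrite -lee_fin -sE; apply: nneseries_ge0 => k _ _; rewrite lee_fin (dot_ge0 ip).
Qed.

Lemma section_le_norm2prod U k : (forall k, H (fun w => U (k, w))) ->
  ((Num.sqrt (dot (cls (fun w => U (k, w))) (cls (fun w => U (k, w)))))%:E <=
   norm2prod U)%E.
Proof.
move=> HU; rewrite norm2prod_sections// -powR12_sqrt ?(dot_ge0 ip)// -poweR_EFin.
have s0 j : (0 <= (dot (cls (fun w => U (j, w))) (cls (fun w => U (j, w))))%:E)%E.
  by rewrite lee_fin (dot_ge0 ip).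
apply: gt0_ler_poweR; rewrite ?invr_ge0//.
- by rewrite in_itv/= s0 leey.
- by rewrite in_itv/= nneseries_ge0// leey.
- by rewrite (nneseriesD1 (n := k))// leeDl//; exact: nneseries_ge0.
Qed.

Lemma cvge0_lt (a : nat -> \bar R) : (a @ \oo --> 0%E) ->
  forall e : R, 0 < e -> \forall n \near \oo, (a n < e%:E)%E.
Proof.
move=> /fine_cvgP[fa /cvgrPdist_lt a0] e e0.
apply: filterS2 fa (a0 _ e0) => n an; rewrite sub0r normrN => /=.
by rewrite -(fineK an) lte_fin; apply: le_lt_trans; exact: ler_norm.
Qed.

Lemma gradient_smooth_cls F k : H F ->
  H (fun w => gradient_smooth F (k, w)) /\
  cls (fun w => gradient_smooth F (k, w)) = dmal k (cls F).
Proof. exact: malliavin_cls. Qed.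

(** Convergence in the product norm forces convergence of each section, and D_k contracts, so the
    limit of the k-th sections is D_k F. In particular every [U] over the same [F] has the same
    classes of sections, which is closability. *)
Lemma gradient_graph_section F U : gradient_graph F U -> forall k,
  H (fun w => U (k, w)) /\ cls (fun w => U (k, w)) = dmal k (cls F).
Proof.
move=> [/L2XE HF LU [f [sf fF fU]]] k; have HU j := L2prod_section j LU.
split=> //; have Hf n : H (f n) by case: (sf n) => /L2XE.
have Hg n j : H (fun w => gradient_smooth (f n) (j, w)).
  by case: (gradient_smooth_cls j (Hf n)).
have {}fF : hlim dot \oo (fun n => cls (f n)) (cls F) by apply/norm2_cvg.
have Df : hlim dot \oo (fun n => dmal k (cls (f n))) (dmal k (cls F)).
  by apply: hlim_le fF => n; rewrite -(dmalN hs) -(dmalD hs); exact: dmal_le.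
apply: (hlim_unique ip _ Df) => e e0.
have se : 0 < Num.sqrt e by rewrite sqrtr_gt0.
apply: filterS (cvge0_lt fU se) => n nU.
have HgU j : H (fun w => gradient_smooth (f n) (j, w) - U (j, w)).
  exact: (L2B sH (Hg n j) (HU j)).
have := le_lt_trans (section_le_norm2prod k HgU) nU.
rewrite lte_fin ltr_sqrt//.
have -> : cls (fun w => gradient_smooth (f n) (k, w) - U (k, w)) =
    dmal k (cls (f n)) - cls (fun w => U (k, w)).
  have [_ <-] := gradient_smooth_cls k (Hf n).
  exact: (clsB (Hg n k) (HU k)).
by [].
Qed.

Lemma gradient_graph_number F N : H F -> number_op (cls F) N ->
  gradient_graph F (gradient_smooth F).
Proof.
move=> HF xN; have HD k := gradient_smooth_cls k HF.
have LU : L2prod (gradient_smooth F).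
  by have [] := @norm2prod_dmal (gradient_smooth F) (cls F) N
    (fun k => proj1 (HD k)) (fun k => proj2 (HD k)) xN.
pose f n := cond_exp P (rv_sets X `I_n) F.
have fP n : L2F X `I_n (f n) /\ cls (f n) = cexp `I_n (cls F).
  exact: cond_expP.
have Hf n : H (f n) by case: (fP n) => /L2FT.
split => //; first exact/L2XE.
exists f; split.
- move=> n; split; first exact/L2XE.
  by exists n; case: (fP n) => -[].
- apply/norm2_cvg => //; have := proj_lim hs (cls F).
  by apply: hlim_near; apply: nearW => n; case: (fP n).
(* Truncation commutes with the number operator, so the energy identity makes the squared distance
   of the gradients the pairing of two tails, both tending to 0. *)
- pose x n := cls F - cexp `I_n (cls F); pose y n := N - cexp `I_n N.
  have nE n : norm2prod (fun z => gradient_smooth (f n) z - gradient_smooth F z) =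
      (Num.sqrt (dot (x n) (y n)))%:E.
    have HDf k := gradient_smooth_cls k (Hf n).
    have xy : number_op (- x n) (- y n).
      by move=> M; rewrite !(compN hs) (number_subproj hs n xN) scalerN.
    pose W (z : nat * TX X) := gradient_smooth (f n) z - gradient_smooth F z.
    have HW k : H (fun w => W (k, w)) := L2B sH (proj1 (HDf k)) (proj1 (HD k)).
    have WE k : cls (fun w => W (k, w)) = dmal k (- x n).
      rewrite [LHS](clsB (proj1 (HDf k)) (proj1 (HD k))).
      rewrite (proj2 (HDf k)) (proj2 (HD k)) -(dmalN hs) -(dmalD hs) /x opprB.
      by case: (fP n) => _ ->.
    have [_ ->] := norm2prod_dmal HW WE xy.
    by rewrite (dotNl ip) (dotNr ip) opprK.
  apply/fine_cvgP; split; first by apply: nearW => n; rewrite nE.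
  apply/cvgrPdist_lt => e e0; have e2 : 0 < e ^+ 2 by rewrite exprn_gt0.
  apply: filterS2 (proj_lim hs (cls F) e2) (proj_lim hs N e2) => n h1 h2.
  rewrite /= nE/= sub0r normrN ger0_norm ?sqrtr_ge0// -(ger0_norm (ltW e0)) -sqrtr_sqr.
  rewrite ltr_sqrt//.
  by apply: (dot_lt ip); rewrite /x /y -opprB (dotNl ip) (dotNr ip) opprK.
Qed.

Lemma gradient_graph_smooth F n : L2F X `I_n F -> gradient_graph F (gradient_smooth F).
Proof.
move=> LF; apply: (gradient_graph_number (N := mdiv n (cls F))); first exact: L2FT LF.
apply: (number_smooth hs); apply: cexp_eq => //.
by apply: is_proj_id; exists F.
Qed.

Lemma dom_gradient_smooth F n : L2F X `I_n F -> dom_gradient F.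
Proof. by exists (gradient_smooth F); exact: (@gradient_graph_smooth F n). Qed.

Lemma gradientP F : dom_gradient F -> gradient_graph F (gradient F).
Proof. exact: (@getPex _ [set U | gradient_graph F U]). Qed.

Lemma dom_gradient_L2 F : dom_gradient F -> H F.
Proof. by move=> [U []] /L2XE. Qed.

(** The partial sums of the D_k F need not converge at this stage; only their pairings with elements
    of the domain are shown to converge. *)
Lemma inner_gradient F G : dom_gradient F -> dom_gradient G ->
  exists2 r : R, inner_prod (gradient G) (gradient F) = r%:E &
    dot (cls G) (mdiv m (cls F)) @[m --> \oo] --> r.
Proof.
move=> /gradientP gF /gradientP gG; have [_ LF _] := gF; have [_ LG _] := gG.
have [r rE rl] := inner_prod_lim LG LF; exists r => //.
have -> // : (fun m => dot (cls G) (mdiv m (cls F))) =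
  (fun m => \sum_(k < m) dot (cls (fun w => gradient G (k : nat, w)))
                             (cls (fun w => gradient F (k : nat, w)))).
apply/funext => m; rewrite -(dot_mdiv hs); apply: eq_bigr => k _.
have [_ ->] := gradient_graph_section gG k.
by have [_ ->] := gradient_graph_section gF k.
Qed.

Lemma inner_gradient_number F G N : dom_gradient F -> dom_gradient G ->
  number_op (cls F) N ->
  inner_prod (gradient G) (gradient F) = (dot (cls G) N)%:E.
Proof.
move=> dF dG xN; have [r -> rl] := inner_gradient dF dG; congr EFin.
apply: (norm_cvg_unique rl); rewrite [dot _ N](dotC ip).
have -> : (fun m => dot (cls G) (mdiv m (cls F))) =
    (fun m => dot (mdiv m (cls F)) (cls G)).
  by apply/funext => m; exact: (dotC ip).
exact: (hlim_dot ip (mdiv_lim hs xN)).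
Qed.

Lemma dom_OU_number F : dom_OU F -> exists N, number_op (cls F) N.
Proof.
move=> [dF [LgF [C FC]]].
(* The constant in the domain of the divergence has no sign condition, hence its absolute value. *)
apply: (@number_ex _ _ _ _ hs (`|C| ^+ 2)); apply: (adjoint_bounded hs) => // n y Ey.
have [[g Lg gE] _] := cexpP indep `I_n y; rewrite Ey in gE.
have dg := dom_gradient_smooth Lg.
have [r rE rl] := inner_gradient dF dg.
(* For y measurable for F_n the pairings no longer change from index n on, so the limit is attained
   there. *)
have -> : dot y (mdiv n (cls F)) = r.
  rewrite -gE; apply: (norm_cvg_unique _ rl); apply: cvg_near_cst.
  exists n => // m /= nm; rewrite -!(mdiv_sym hs).
  by rewrite (mdiv_smooth hs _ nm)// gE.
have := FC g dg; rewrite rE norm2E; last exact: L2FT Lg.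
rewrite -EFinM lee_fin => rC; apply: le_trans (ler_norm _) _.
apply: le_trans rC _; rewrite -gE (dotV_cls (L2FT Lg) (L2FT Lg)).
by rewrite ler_wpM2r ?sqrtr_ge0// ler_norm.
Qed.

Lemma number_dom_OU F N : H F -> number_op (cls F) N -> dom_OU F.
Proof.
move=> HF xN; have dF : dom_gradient F.
  by exists (gradient_smooth F); exact: gradient_graph_number xN.
split => //; split; first by case: (gradientP dF).
(* By Cauchy-Schwarz the norm of [N] serves as the constant. *)
exists (Num.sqrt (dot N N)) => G dG.
rewrite (inner_gradient_number dF dG xN) norm2E; last exact: dom_gradient_L2.
have HG := dom_gradient_L2 dG.
rewrite -EFinM abse_EFin lee_fin mulrC -(dotV_cls HG HG).
exact: (dot_le_sqrt ip).
Qed.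

(** A representative of [N] satisfies the adjoint relation, so [get] selects some D. Then z = D - N
    is orthogonal to every smooth class, in particular to its own projections onto F_n, which
    converge to z. *)
Lemma OU_cls F N : dom_OU F -> number_op (cls F) N ->
  H (OU F) /\ cls (OU F) = - N.
Proof.
move=> [dF _] xN.
pose D := divergence (gradient F).
have [/L2XE HD DP] : L2X D /\ forall G, dom_gradient G ->
    inner_prod (gradient G) (gradient F) = 'E_P[fun w : T => (G w * D w)%R]%E.
  apply: (@getPex _ [set D | L2X D /\ forall G, dom_gradient G ->
    inner_prod (gradient G) (gradient F) = 'E_P[fun w : T => (G w * D w)%R]%E]).
  exists (rep N); split; first exact/L2XE/rep_L2.
  move=> G dG; rewrite (inner_gradient_number dF dG xN).
  rewrite expectation_mul ?repK//; first exact: dom_gradient_L2.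
  exact: rep_L2.
have DE : cls D = N.
  apply/eqP; rewrite -subr_eq0; apply/eqP/(dot_eq0 ip).
  set z := cls D - N.
  apply: (norm_cvg_unique (hlim_dot ip (y := z) (proj_lim hs z))).
  apply: cvg_near_cst; apply: nearW => n.
  have [[g Lg <-] _] := cexpP indep `I_n z.
  have Hg := L2FT Lg; have dg := dom_gradient_smooth Lg.
  have := DP g dg; rewrite (inner_gradient_number dF dg xN) expectation_mul//.
  by move=> [gN]; rewrite /z (dotDr ip) (dotNr ip) gN subrr.
split; first exact: (L2N HD).
by rewrite [LHS](clsN HD) DE.
Qed.

End gradient.

(** * The weighted series of squared norms *)

Section number_operator.
Context d (T : measurableType d) (R : realType) (P : probability T R)
  (dE : nat -> measure_display) (E : forall n, measurableType (dE n))
  (X : forall n, {RV P >-> E n}) (indep : mutually_independent X).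
Local Notation V := (L2space X).
Local Notation dot := (@dotV _ _ _ _ _ _ X).
Local Notation cls := (cls X).
Local Notation H := (L2F X setT).
Local Notation cexp := (@cexp _ _ _ _ _ _ X).
Local Notation comp := (comp cexp).
Local Notation mdiv := (mdiv cexp).
Local Notation number_op := (number_op cexp).
Let ip : inner_product dot := dotV_inner X.
Let hs : hoeffding_space dot cexp := cexp_space indep.
Implicit Types (F G : TX X -> R) (x y N : V) (M K : {fset nat}).

Definition number_sum x : \bar R := (\esum_(M in [set: {fset nat}])
  (#|` M|%:R ^+ 2 * dot (comp M x) (comp M x))%:E)%E.

Lemma number_sumE F : H F ->
  (\esum_(M in [set: {fset nat}]) ((#|` M|%:R ^+ 2)%R%:E *
     'E_P[fun w : T => (hoeffding F M w ^+ 2)%R]) = number_sum (cls F))%E.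
Proof.
move=> HF; apply: eq_esum => M _; rewrite expectation_sqr; last exact: hoeffding_L2.
by rewrite (proj2 (hoeffding_cls indep M HF)) -EFinM.
Qed.

(** A nonnegative family over finite sets is regrouped by cardinality, Parseval giving the
    contribution of each order. The order 0 carries weight 0, which reconciles a series starting at
    1 with a sum over all sets. *)
Lemma number_sum_order F : H F ->
  (\sum_(1 <= p <oo) ((p%:R ^+ 2)%R%:E *
     'E_P[fun w : T => (hoeffding_order F p w ^+ 2)%R]) = number_sum (cls F))%E.
Proof.
move=> HF.
pose a M : \bar R := (#|` M|%:R ^+ 2 * dot (comp M (cls F)) (comp M (cls F)))%:E.
pose J p : set {fset nat} := [set M : {fset nat} | #|` M| = p].
have a0 M : (0 <= a M)%E by rewrite lee_fin mulr_ge0 ?sqr_ge0 ?(dot_ge0 ip).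
have pE p : ((p%:R ^+ 2)%R%:E * 'E_P[fun w : T => (hoeffding_order F p w ^+ 2)%R] =
    \esum_(M in J p) a M)%E.
  have [Hp pP] := hoeffding_orderP indep p HF.
  rewrite expectation_sqr// -EFinM expr2 -mulrA -(dotZr ip) -(dotZl ip).
  rewrite (sqr_esum hs) [RHS]esum_mkcond; apply: eq_esum => M _.
  rewrite (compZ hs) pP /a; case: ifPn => [Mp|Mp].
    rewrite ifT ?inE/=; last exact/eqP.
    by rewrite (dotZl ip) (dotZr ip) mulrA -expr2 (eqP Mp).
  by rewrite ifF ?scaler0 ?(dot0l ip)//; apply/negbTE; rewrite notin_setE/=; exact/eqP.
have b0 p : (0 <= \esum_(M in J p) a M)%E by exact: esum_ge0.
transitivity (\sum_(0 <= p <oo) \esum_(M in J p) a M)%E.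
  under eq_eseriesr do rewrite pE.
  rewrite [RHS](nneseries_split 0 1)// big_nat1.
  rewrite (_ : \esum_(M in J 0%N) a M = 0)%E ?add0e//.
  by rewrite esum1// => M /= M0; rewrite /a M0 expr0n mul0r.
have tJ : trivIset setT J by move=> p q _ _ [M [/= <-]].
have := @esum_bigcupT _ _ _ J a tJ a0; rewrite nneseries_esumT// => <-; congr (esum _ _).
by apply/seteqP; split => // M _; exists #|` M|.
Qed.

Lemma number_sum_finite x : (number_sum x < +oo)%E -> exists N, number_op x N.
Proof.
move=> xy; apply: (@number_ex _ _ _ _ hs (fine (number_sum x))) => n.
have s0 M : (0 <= (#|` M|%:R ^+ 2 * dot (comp M x) (comp M x))%:E)%E.
  by rewrite lee_fin mulr_ge0 ?sqr_ge0 ?(dot_ge0 ip).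
have fx : number_sum x \is a fin_num by rewrite ge0_fin_numE//; exact: esum_ge0.
rewrite -lee_fin fineK// -sumEFin; apply: esum_ge.
exists [set` fpowerset (box n)]; first by split => //; exact: finite_fset.
by rewrite fsbig_finite//= set_fsetK.
Qed.

Lemma number_op_finite x N : number_op x N -> (number_sum x < +oo)%E.
Proof.
move=> xN; have -> : number_sum x = (dot N N)%:E; last exact: ltry.
rewrite (sqr_esum hs); apply: eq_esum => M _.
by rewrite xN (dotZl ip) (dotZr ip) mulrA -expr2.
Qed.

Lemma sum_order_lim (B : {fset nat}) x N (y : nat -> V) : number_op x N ->
  (forall p M, comp M (y p) = if #|` M| == p then comp M x else 0) ->
  forall M, comp M (\sum_(p <- B | (1 <= p)%N) - (p%:R *: y p)) =
    if #|` M| \in B then comp M (- N) else 0.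
Proof.
move=> xN yE M; rewrite (comp_sum hs) (compN hs) xN.
have tE p : comp M (- (p%:R *: y p)) = if #|` M| == p then - (#|` M|%:R *: comp M x) else 0.
  rewrite (compN hs) (compZ hs) yE; case: eqP => [->//|_].
  by rewrite scaler0 oppr0.
under eq_bigr do rewrite tE.
case: ifPn => MB; last first.
  rewrite big1_seq// => p /andP[_ pB]; case: eqP => // Mp.
  by rewrite Mp pB in MB.
rewrite big_mkcond (big_fsetD1 #|` M|)//= big1_seq ?addr0.
  (* The empty set is excluded by the condition on p, but its target component carries the factor 0
     as well. *)
  by rewrite eqxx; case: posnP => // ->; rewrite scale0r oppr0.
move=> p /andP[_]; rewrite !inE => /andP[pM _].
by rewrite eq_sym (negbTE pM); case: ifP.
Qed.

End number_operator.

(** * The equivalences and the decomposition of the generator *)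

Theorem proposition2p7 (d : measure_display) (T : measurableType d)
    (R : realType) (P : probability T R)
    (dE : nat -> measure_display) (E : forall n, measurableType (dE n))
    (X : forall n, {RV P >-> E n}) (indep : mutually_independent X)
    (F : TX X -> R) (hF : L2X F) :
  [/\ (\sum_(1 <= p <oo) ((p%:R ^+ 2)%R%:E *
         'E_P[fun w : T => (hoeffding_order F p w ^+ 2)%R]) =
       \esum_(M in [set: {fset nat}]) ((#|` M|%:R ^+ 2)%R%:E *
         'E_P[fun w : T => (hoeffding F M w ^+ 2)%R]))%E,
      [<-> dom_OU F;
           exists G, L2_lim \oo (fun m w => \sum_(k < m) malliavin_D k F w) G;
           (ereal_sup (range (fun m : nat =>
              'E_P[fun w : T => ((\sum_(k < m) malliavin_D k F w) ^+ 2)%R]))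
            < +oo)%E;
           (\sum_(1 <= p <oo) ((p%:R ^+ 2)%R%:E *
              'E_P[fun w : T => (hoeffding_order F p w ^+ 2)%R]) < +oo)%E] &
      dom_OU F ->
      [/\ L2_lim \oo (fun m w => - \sum_(k < m) malliavin_D k F w) (OU F),
          forall M : {fset nat},
            hoeffding (OU F) M = (fun w => - (#|` M|%:R * hoeffding F M w))
              %[ae P],
          forall p : nat,
            hoeffding_order (OU F) p =
              (fun w => - (p%:R * hoeffding_order F p w)) %[ae P],
          L2_sum predT
            (fun (M : {fset nat}) w => - (#|` M|%:R * hoeffding F M w)) (OU F) &
          L2_sum (fun p : nat => (1 <= p)%N)
            (fun p w => - (p%:R * hoeffding_order F p w)) (OU F)]].
Proof.
have HF : L2F X setT F by exact/L2XE.
have ip := dotV_inner X; have hs := cexp_space indep.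
have Hm m := sum_malliavin_cls indep m HF.
split.
- by rewrite number_sum_order// number_sumE.
(* Three arrows of the cycle produce an [N] with [number_op] and read off the conclusion; the arrow
   from convergence to boundedness is the boundedness of a convergent sequence of squared norms. *)
- rewrite number_sum_order//; tfae.
  + move=> /(dom_OU_number indep)[N xN]; exists (rep N).
    apply/L2_limE => [m|]; first by case: (Hm m).
    split; first exact: rep_L2.
    rewrite repK; apply: hlim_near (mdiv_lim hs xN); apply: nearW => m.
    by case: (Hm m).
  + move=> [G /L2_limE[m|HG mG]]; first by case: (Hm m).
    have /cvg_seq_bounded[C [_ mC]] : cvgn (fun m =>
        dotV (mdiv (@cexp _ _ _ _ _ _ X) m (cls X F)) (mdiv (@cexp _ _ _ _ _ _ X) m (cls X F))).
      apply/cvg_ex; eexists; apply: (hlim_sqr ip).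
      by apply: hlim_near mG; apply: nearW => m; case: (Hm m).
    apply: (@le_lt_trans _ _ (C + 1)%:E); last exact: ltry.
    apply: ub_ereal_sup => _ [m _ <-]; rewrite (expectation_sqr (proj1 (Hm m))).
    rewrite (proj2 (Hm m)) lee_fin; apply: le_trans (ler_norm _) _.
    by apply: mC => //; rewrite ltrDl.
  + set s := ereal_sup _ => sy.
    have ms m : ((dotV (mdiv (@cexp _ _ _ _ _ _ X) m (cls X F))
        (mdiv (@cexp _ _ _ _ _ _ X) m (cls X F)))%:E <= s)%E.
      apply: ereal_sup_ubound; exists m => //.
      by rewrite (expectation_sqr (proj1 (Hm m))) (proj2 (Hm m)).
    have fs : s \is a fin_num.
      by rewrite ge0_fin_numE//; apply: le_trans (ms 0%N); rewrite lee_fin (dot_ge0 ip).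
    have [|N xN] := @number_ex _ _ _ _ hs (fine s) (cls X F).
      apply: (mdiv_bounded hs) => m; rewrite -lee_fin (fineK fs); exact: ms.
    exact: (number_op_finite indep xN).
  + by move=> /(number_sum_finite indep)[N]; exact: number_dom_OU.
move=> dF; have [N xN] := dom_OU_number indep dF.
have [HY YE] := OU_cls indep dF xN.
have HMh (M : {fset nat}) : L2F X setT (fun w => - (#|` M|%:R * hoeffding F M w)).
  by apply/L2N/L2Z; exact: hoeffding_L2.
have clsMh (M : {fset nat}) : cls X (fun w => - (#|` M|%:R * hoeffding F M w)) =
    - #|` M|%:R *: comp (@cexp _ _ _ _ _ _ X) M (cls X F).
  have HM := hoeffding_L2 indep M HF.
  rewrite (clsN (L2Z _ HM)) (clsZ _ HM) scaleNr.
  by rewrite (proj2 (hoeffding_cls indep M HF)).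
have Hp p : L2F X setT (fun w => - (p%:R * hoeffding_order F p w)).
  by apply/L2N/L2Z; case: (hoeffding_orderP indep p HF).
have clsp p : cls X (fun w => - (p%:R * hoeffding_order F p w)) =
    - (p%:R *: cls X (hoeffding_order F p)).
  have [Hq _] := hoeffding_orderP indep p HF.
  by rewrite (clsN (L2Z _ Hq)) (clsZ _ Hq).
split.
- apply/L2_limE => [m|]; first by apply: L2N; case: (Hm m).
  split => //; rewrite YE -scaleN1r.
  apply: hlim_near (hlimZ ip (-1) (mdiv_lim hs xN)); apply: nearW => m; rewrite scaleN1r.
  by case: (Hm m) => Hs <-; rewrite -(clsN Hs).
- move=> M; apply: (cls_inj_ae (X := X)) => //; first exact: hoeffding_L2.
  rewrite (proj2 (hoeffding_cls indep M HY)) YE (compN hs) xN clsMh.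
  by rewrite scaleNr.
- move=> p; have [HYp YpE] := hoeffding_orderP indep p HY.
  have [_ FpE] := hoeffding_orderP indep p HF.
  apply: (cls_inj_ae (X := X)) => //; apply: (comp_inj hs) => M.
  rewrite YpE clsp YE (compN hs) xN (compN hs) (compZ hs) FpE.
  by case: eqP => [->//|_]; rewrite scaler0 oppr0.
- apply/(L2_sumE _ _ HMh); split => //.
  have := @sum_multiplier_lim _ _ _ _ _ _ _ indep predT
    (fun M => - #|` M|%:R) (cls X F) (cls X (OU F)).
  under eq_fun do under eq_bigr do rewrite -clsMh.
  by apply => M; rewrite YE (compN hs) xN scaleNr.
- apply/(L2_sumE _ _ Hp); split => //.
  have sE (B : {fset nat}) M := sum_order_lim indep B xN
    (fun p => proj2 (hoeffding_orderP indep p HF)) M.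
  under eq_fun do under eq_bigr do rewrite clsp.
  (* This series is indexed by orders, so the domination by the limit is checked directly; the
     component at M is final once the index set contains its cardinality. *)
  apply: (@hlim_comp0 _ _ _ _ hs _ _ _ _ _ (cls X (OU F))) => [B M|M].
    rewrite (compD hs) (compN hs) sE YE; case: ifP => _.
      by rewrite subrr (dot0l ip) (dot_ge0 ip).
    by rewrite sub0r (dotNl ip) (dotNr ip) opprK.
  exists [fset #|` M|]%fset => // B /= MB; rewrite sE YE.
  by rewrite (fsubsetP MB)// inE.
Qed.
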